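(* For a prime $p$, let $u_p$ denote the smallest $u$ such that there exists a primitive root modulo $p$ with exactly $u$ non-zero binary digits. Then for all but at most $Q^{26/33+o(1)}$ primes $p\le Q$, we have $u_p\le 3$, as $Q\to\infty$.
   Context: A primitive root modulo $p$ is a positive integer $g$ whose residue class generates the multiplicative group $\mathbb{F}_p^*$ (it is not required that $g<p$); its number of non-zero binary digits is the number of digits $1$ in its base-$2$ expansion. The $o(1)$ denotes a quantity tending to $0$ as $Q\to\infty$; that is, for every $\epsilon>0$ and all sufficiently large $Q$, the number of primes $p\le Q$ with $u_p>3$ is at most $Q^{26/33+\epsilon}$. *)

(* Defs.v *)
From mathcomp Require Import all_boot all_order all_algebra all_fingroup.
From mathcomp Require Import all_solvable all_field.
From mathcomp Require Import all_classical all_reals all_analysis.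

Set Implicit Arguments.
Unset Strict Implicit.
Unset Printing Implicit Defensive.

Import Order.TTheory GRing.Theory Num.Theory.

Local Open Scope ring_scope.

(* The positions i < n suffice, since n < 2 ^ n. *)
Definition nonzero_binary_digits (n : nat) : nat :=
  (\sum_(i < n) (n %/ 2 ^ i) %% 2)%N.

(* Meaningful for p prime only: MathComp's 'F_p is the field of order pdiv p. *)
Definition primitive_root_mod (p g : nat) : bool :=
  (0 < g)%N && [exists x : {unit 'F_p},
    (FinRing.uval x == g%:R) && generator [set: {unit 'F_p}] x].

Definition has_primitive_root_with_digits (p u : nat) : Prop :=
  exists g : nat, primitive_root_mod p g /\ nonzero_binary_digits g = u.

Lemma has_primitive_root_with_digits_ex (p : nat) :
  exists u : nat, `[< has_primitive_root_with_digits p u >].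
Proof.
have /cyclicP [x defx] := field_unit_group_cyclic [set: {unit 'F_p}]%G.
pose g : nat := FinRing.uval x.
exists (nonzero_binary_digits g); apply/asboolP; exists g; split=> //.
apply/andP; split.
  rewrite lt0n; apply/negP => /eqP g0.
  have := valP x; rewrite /= unitfE => /negP; apply.
  by apply/eqP/val_inj.
apply/existsP; exists x; rewrite /g natr_Zp eqxx /=.
by rewrite /generator -defx.
Qed.

(* The quantity u_p; like primitive_root_mod, meaningful for p prime only. *)
Definition least_digits (p : nat) : nat :=
  ex_minn (has_primitive_root_with_digits_ex p).

Definition exceptional_count (R : realType) (Q : R) : nat :=
  #|[set p : 'I_(Num.truncn Q).+1 | prime p & (3 < least_digits p)%N]|.

(* Main.v *)
Require Import Defs.
From mathcomp Require Import all_boot all_order all_algebra.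
From mathcomp Require Import all_classical all_reals all_analysis.
From mathcomp Require Import all_fingroup all_solvable all_field.
From mathcomp Require Import zify ring lra.

Import Order.TTheory GRing.Theory Num.Theory.

Set Implicit Arguments.
Unset Strict Implicit.
Unset Printing Implicit Defensive.

Local Open Scope ring_scope.

(** Let t be the order of 2 modulo an odd prime p, let H be the group of powers
    of 2, so that H is the group of t-th roots of unity in F_p, and write
    p - 1 = n t.

    Few primes have small order: if t <= T then p divides 2^k - 1 for some
    k <= T, and 2^k - 1 has at most k prime divisors, so at most T^2 primes occur.
    With T = Q^(13/33) this is the bound of the theorem, and it remains to find,
    when t^33 >= p^13 and p is large, a primitive root with three binary digits.

    Multiplying by an element of H does not change the set of sums h1 + h2 + h3
    with h_i in H, and every element of H is a power of 2 with exponent in any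
    prescribed window of length t.  Hence a sum of three elements of H in the
    coset of a primitive root gives distinct exponents a, b, c such that
    2^a + 2^b + 2^c is a primitive root.  Since H has index n, a coset contains
    a primitive root as soon as its elements are not r-th powers for any prime r
    dividing n ([primitive_in_coset]).

    To find such a sum, write it as x + h, where x carries a weight w supported
    on the sums of two elements of H.  For a subgroup K of index d containing H,
    the number of h in H with x + h in K has variance at most p t when x ranges
    over F_p: summed over all cosets of K, the second moment counts the x for
    which (x + h)/(x + h') lies in K, and for h <> h' this ratio takes every
    value at most once ([variance_coset_count]).  By Cauchy-Schwarz and
    inclusion-exclusion over the primes r, the sieve succeeds when p times the sum
    of w^2 is smaller than t (sum of w)^2, up to a factor p^o(1)
    ([exists_sum_avoiding_powers]).

    If w counted all representations x = h1 + h2, this would demand a bound for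
    the additive energy of H.  Instead w ignores the popular x, those with at
    least tau = t^3 / p^(1+o(1)) representations.  Then the condition on w holds,
    provided that the popular x do not account for nearly all pairs (h1, h2)
    ([few_popular_sums]).  Suppose that they do, and let P be the set of
    popular sums.  Then P has at most t^2 / tau elements, the energy is at least
    about tau t^2, and for each difference d = x - z of elements of H nearly all
    y in H give a pair (x + y, z + y) of elements of P at distance d.  Stepanov's
    method bounds the number of pairs in P at distance d by about
    (|P|^2 / t)^(2/3) and the sum of the cubes of the numbers of representations
    of differences by about t^3.  A Cauchy-Schwarz inequality over these pairs
    gives tau^7 <= t^(3+o(1)), whereas t^33 >= p^13 makes tau about
    t^(6/13) or larger: a contradiction, because 6/13 > 3/7. *)

(** * Sparse polynomials modulo p *)

Section SparsePolynomials.

Variables (F : fieldType) (p : nat).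
Hypothesis charFp : p \in [pchar F].

Lemma natr_eq0_small (n : nat) : (n < p)%N -> n%:R = 0 :> F -> n = 0%N.
Proof.
move=> n_lt /eqP; rewrite -(dvdn_pcharf charFp) => p_dvd.
by apply/eqP; rewrite -leqn0 leqNgt; apply/negP => /dvdn_leq /(_ p_dvd); rewrite leqNgt n_lt.
Qed.

Lemma natr_inj_small (m n : nat) :
  (m < p)%N -> (n < p)%N -> m%:R = n%:R :> F -> m = n.
Proof.
wlog le_mn : m n / (m <= n)%N.
  move=> IH; case/orP: (leq_total m n) => le; first exact: IH.
  by move=> lt_m lt_n e; apply/esym/IH.
move=> _ lt_n e; apply/eqP; rewrite eqn_leq le_mn -subn_eq0 /=.
apply/eqP/natr_eq0_small; first exact: leq_ltn_trans (leq_subr _ _) lt_n.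
by rewrite natrB // e subrr.
Qed.

(** In characteristic p a nonzero polynomial of degree less than p with N terms
    vanishes at 1 to order less than N.  The operator f |-> X f' - e f kills the
    term of exponent e, keeps the other terms because exponents are distinct
    modulo p, and lowers the order of vanishing by at most one. *)
Lemma sparse_poly_eq0 (N : nat) (f : {poly F}) :
  (size f <= p)%N -> (#|[set i : 'I_p | (f`_i != 0)%R]| <= N)%N ->
  ('X - 1%:P) ^+ N %| f -> f = 0.
Proof.
elim: N f => [|N IH] f size_f supp_f dvd_f.
  apply/polyP => i; rewrite coef0.
  case: (ltnP i p) => [i_lt|]; last by move=> le_i; apply: (leq_sizeP _ _ size_f).
  apply/eqP/negPn/negP => fi; move: supp_f;
    rewrite leqn0 cards_eq0 => /eqP/setP/(_ (Ordinal i_lt)).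
  by rewrite !inE fi.
apply/eqP/negPn/negP => f_neq0.
have [e fe] : exists e : 'I_p, f`_e != 0.
  have e_lt : ((size f).-1 < p)%N by rewrite prednK // lt0n size_poly_eq0.
  by exists (Ordinal e_lt); rewrite /= -lead_coefE lead_coef_eq0.
pose g := 'X * f^`() - e%:R *: f.
have coef_g i : g`_i = (i%:R - e%:R) * f`_i.
  rewrite /g coefB coefZ coefXM coef_deriv; case: i => [|i] /=.
    by rewrite mulrBl mulr0n mul0r.
  by rewrite mulrBl !mulr_natl.
have g0 : g = 0.
  apply: IH.
  - apply/leq_sizeP => j le_j; rewrite coef_g.
    by rewrite (leq_sizeP _ _ size_f) ?mulr0.
  - rewrite -ltnS; apply: leq_trans supp_f; rewrite (cardsD1 e [set i : 'I_p | f`_i != 0]).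
    rewrite inE fe add1n ltnS; apply: subset_leq_card; apply/fintype.subsetP => i.
    rewrite !inE coef_g => h; apply/andP; split.
      by apply: contraNneq h => ->; rewrite subrr mul0r.
    by apply: contraNneq h => ->; rewrite mulr0.
  - have [q def_f] := dvdpP _ _ dvd_f; rewrite /g def_f.
    rewrite derivM deriv_exp derivXsubC mul1r /=.
    rewrite mulrDr; apply: dvdp_sub; first apply: dvdp_add.
    + by rewrite mulrA dvdp_mull // dvdp_exp2l.
    + by rewrite mulrA dvdp_mull // -mulr_natl dvdp_mull.
    + by rewrite -mul_polyC mulrA dvdp_mull // dvdp_exp2l.
have f_mono : f = f`_e *: 'X^e.
  apply/polyP => i; rewrite coefZ coefXn; case: eqP => [->|/eqP ne]; first by rewrite mulr1.
  rewrite mulr0; case: (ltnP i p) => [i_lt|]; last by move=> le_i;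
    apply: (leq_sizeP _ _ size_f).
  have := coef_g i; rewrite g0 coef0 => /esym/eqP; rewrite mulf_eq0 => /orP[|/eqP //].
  by rewrite subr_eq0 => /eqP/natr_inj_small e'; rewrite e' ?eqxx // in ne.
have : root f 1.
  by rewrite -dvdp_XsubCl; apply: dvdp_trans dvd_f; rewrite exprS dvdp_mulr.
by rewrite f_mono rootE hornerZ hornerXn expr1n mulr1 (negPf fe).
Qed.

End SparsePolynomials.

(** * Stepanov's method *)

Section AuxiliaryPolynomials.

Variables (F : fieldType) (p : nat).
Hypothesis charFp : p \in [pchar F].

Lemma underdetermined_system (I J : finType) (c : I -> J -> F) :
  (#|J| < #|I|)%N ->
  exists2 lam : I -> F, (exists i, lam i != 0) &
    forall j, \sum_i lam i * c i j = 0.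
Proof.
move=> ltJI; pose M := \matrix_(i < #|I|, j < #|J|) c (enum_val i) (enum_val j).
have : kermx M != 0.
  rewrite kermx_eq0; apply/negP => /eqP rankM.
  by move: ltJI; rewrite ltnNge -{1}rankM rank_leq_col.
case/rowV0Pn => v /sub_kermxP vM v_neq0.
exists (fun i => v 0 (enum_rank i)).
  have [k vk] : exists k, v 0 k != 0.
    apply/existsP; apply: contraR v_neq0 => /existsPn v0.
    by apply/eqP/rowP => k; rewrite mxE; apply/eqP/negPn/v0.
  by exists (enum_val k); rewrite enum_valK.
move=> j; move/matrixP/(_ 0 (enum_rank j)): vM; rewrite !mxE => vMj; apply: etrans vMj.
rewrite [RHS](reindex (@enum_rank I)) /=; last exact/onW_bij/enum_rank_bij.
by apply: eq_bigr => i _; rewrite mxE !enum_rankK.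
Qed.

(** Multiplying the derivative by X (X - 1) preserves the order of vanishing away
    from 0 and 1, and makes the monomials X^m (X - 1)^n eigenvectors up to a
    polynomial factor of degree 1 ([theta_twist]), whatever m and n are. *)
Definition theta (f : {poly F}) := 'X * ('X - 1%:P) * f^`().

(** A zero of exact order j < p of f is a zero of exact order j - 1 of theta f,
    because j is invertible in characteristic p. *)
Lemma dvdp_exp_theta (D : nat) (f : {poly F}) (x : F) :
  x != 0 -> x != 1 -> (D <= p)%N ->
  (forall k, (k < D)%N -> root (iter k theta f) x) ->
  ('X - x%:P) ^+ D %| f.
Proof.
move=> x0 x1; elim: D f => [|D IH] f ltDp theta_f; first by rewrite expr0 dvd1p.
have root_f : root f x := theta_f 0%N isT.
have /dvdpP [g def_f] : ('X - x%:P) ^+ D %| f.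
  by apply: IH (ltnW ltDp) _ => k /ltnW; apply: theta_f.
rewrite exprS def_f dvdp_mul2r ?expf_neq0 ?polyXsubC_eq0 // dvdp_XsubCl.
case: D => [|D] in IH ltDp theta_f def_f *.
  by rewrite expr0 mulr1 in def_f; rewrite -def_f.
have : ('X - x%:P) ^+ D.+1 %| theta f.
  by apply: IH (ltnW ltDp) _ => k ltk; rewrite -iterSr; apply: theta_f.
rewrite /theta def_f derivM deriv_exp derivXsubC mul1r /= mulrDr dvdp_addr; last first.
  by rewrite mulrA dvdp_mull.
rewrite -mulr_natl !mulrA exprS dvdp_mul2r ?expf_neq0 ?polyXsubC_eq0 //.
rewrite dvdp_XsubCl rootE !hornerE !mulf_eq0 (negPf x0) subr_eq0 (negPf x1) /=.
have D0 : D.+1%:R == 0 :> F = false.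
  by apply/negP => /eqP /(natr_eq0_small charFp ltDp).
by rewrite -polyC1 hornerMn hornerC D0 orbF.
Qed.

(** The conjugate of [theta] by multiplication by X^m (X - 1)^n. *)
Definition twisted_theta (m n : nat) (Q : {poly F}) :=
  'X * ('X - 1%:P) * Q^`() + (m%:R *: ('X - 1%:P) + n%:R *: 'X) * Q.

Lemma theta_twist (m n : nat) (Q : {poly F}) :
  theta (Q * ('X ^+ m * ('X - 1%:P) ^+ n)) =
    twisted_theta m n Q * ('X ^+ m * ('X - 1%:P) ^+ n).
Proof.
have mulXdX (y : {poly F}) k : y * (y ^+ k.-1 *+ k) = k%:R *: y ^+ k.
  case: k => [|k]; first by rewrite mulr0n mulr0 scale0r.
  by rewrite scaler_nat mulrnAr -exprS.
rewrite /theta /twisted_theta derivM derivM derivXn deriv_exp derivXsubC mul1r.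
have e1 := mulXdX 'X m; have e2 := mulXdX ('X - 1%:P) n.
rewrite -!mul_polyC in e1 e2 *; set y := 'X - 1%:P in e2 *; clearbody y.
set a := _ *+ m in e1 *; set b := _ *+ n in e2 *.
by ring: e1 e2.
Qed.

Lemma size_twisted_theta (m n : nat) (Q : {poly F}) :
  (size (twisted_theta m n Q) <= (size Q).+1)%N.
Proof.
have [->|Q0] := eqVneq Q 0; first by rewrite /twisted_theta deriv0 !mulr0 addr0 size_poly0.
rewrite /twisted_theta; apply: leq_trans (size_polyD _ _) _; rewrite geq_max; apply/andP; split.
  apply: leq_trans (size_polyMleq _ _) _; rewrite size_mul ?polyX_eq0 ?polyXsubC_eq0 //.
  rewrite size_polyX size_XsubC /=; exact: lt_size_deriv.
apply: leq_trans (size_polyMleq _ _) _.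
rewrite -ltnS prednK; last by rewrite addn_gt0 orbC lt0n size_poly_eq0 Q0.
rewrite -(addn2 (size Q)) addnC leq_add2l.
apply: leq_trans (size_polyD _ _) _; rewrite geq_max.
rewrite !(leq_trans (size_scale_leq _ _)) ?size_polyX ?size_XsubC //.
Qed.

Lemma iter_theta_twist (m n k : nat) (Q : {poly F}) :
  iter k theta (Q * ('X ^+ m * ('X - 1%:P) ^+ n)) =
    iter k (twisted_theta m n) Q * ('X ^+ m * ('X - 1%:P) ^+ n).
Proof. by elim: k => //= k ->; rewrite theta_twist. Qed.

Lemma size_iter_twisted_theta (m n k : nat) (Q : {poly F}) :
  (size (iter k (twisted_theta m n) Q) <= size Q + k)%N.
Proof.
elim: k => [|k IH] /=; first by rewrite addn0.
by rewrite addnS; apply: leq_trans (size_twisted_theta _ _ _) _.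
Qed.

Lemma iter_theta_sum (I : finType) (c : I -> F) (f : I -> {poly F}) k :
  iter k theta (\sum_i c i *: f i) = \sum_i c i *: iter k theta (f i).
Proof.
elim: k => //= k ->; rewrite /theta raddf_sum mulr_sumr /=.
by apply: eq_bigr => i _; rewrite derivZ -scalerAr.
Qed.

Section Coefficients.

Variables (t A B : nat).
Variable lam : 'I_A * 'I_B * 'I_B -> F.

(** At a point x where x^t and (x - 1)^t are prescribed, the large powers become
    constants, so that this polynomial of degree about t B behaves like one of
    degree less than A. *)
Definition aux_poly : {poly F} :=
  \sum_i lam i *: ('X ^+ i.1.1 * ('X ^+ (t * i.1.2) * ('X - 1%:P) ^+ (t * i.2))).

Lemma size_aux_poly : (size aux_poly <= A + 2 * (t * B))%N.
Proof.
apply: leq_trans (size_sum _ _ _) _; apply/bigmax_leqP => -[[a b] c] _ /=.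
apply: leq_trans (size_scale_leq _ _) _.
rewrite mulrA -exprD; apply: leq_trans (size_polyMleq _ _) _.
rewrite size_polyXn size_exp_XsubC.
have := ltn_ord a; have := leq_mul (leqnn t) (ltnW (ltn_ord b)).
have := leq_mul (leqnn t) (ltnW (ltn_ord c)); clear; lia.
Qed.

(** Group the terms as sum_c f_c (X - 1)^(t c).  If the sum vanishes, the first
    nonzero f_c is divisible by (X - 1)^t; but f_c has at most A B <= t terms and
    degree less than p, contradicting [sparse_poly_eq0]. *)
Lemma aux_poly_neq0 :
  (A * B <= t)%N -> (t * B <= p)%N -> (exists i, lam i != 0) -> aux_poly != 0.
Proof.
move=> leABt letBp [[[a1 b1] c1] lam1].
have leAt : (A <= t)%N.
  by apply: leq_trans leABt; rewrite leq_pmulr // (leq_ltn_trans _ (ltn_ord b1)).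
pose f (c : 'I_B) : {poly F} :=
  \sum_(ab : 'I_A * 'I_B) lam (ab, c) *: 'X^(ab.1 + t * ab.2).
have aux_f : aux_poly = \sum_c f c * ('X - 1%:P) ^+ (t * c).
  under [RHS]eq_bigr => c _ do rewrite mulr_suml.
  rewrite exchange_big pair_big /=; apply: eq_bigr => -[ab c] _ /=.
  by rewrite -scalerAl exprD mulrA.
pose nz (c : 'I_B) := [exists ab, lam (ab, c) != 0].
have nz1 : nz c1 by apply/existsP; exists (a1, b1).
have [c0 nz0 min_c0] := arg_minnP (fun c : 'I_B => c : nat) nz1.
case/existsP: nz0 => -[a0 b0] lam0.
apply/negP => /eqP; rewrite aux_f (bigD1 c0) //= => /eqP; rewrite addr_eq0 => /eqP eq_f0.
have dvd_f0 : ('X - 1%:P) ^+ (t + t * c0) %| f c0 * ('X - 1%:P) ^+ (t * c0).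
  rewrite eq_f0 dvdpNr; apply: (big_ind (fun g => _ %| g)) => [|g h|c];
    [exact: dvdp0|exact: dvdp_add|].
  case/boolP: (nz c) => [nzc ne|nzc _]; last first.
    rewrite /f big1 ?mul0r ?dvdp0 // => ab _.
    by move: nzc; rewrite negb_exists => /forallP/(_ ab); rewrite negbK => /eqP ->;
      rewrite scale0r.
  apply: dvdp_mull; apply: dvdp_exp2l; rewrite -mulnS leq_mul2l; apply/orP; right.
  by rewrite ltn_neqAle min_c0 // andbT; apply: contraNneq ne => /val_inj ->.
move: dvd_f0; rewrite exprD dvdp_mul2r ?expf_neq0 ?polyXsubC_eq0 // => dvd_f0.
have coef_f (i : nat) :
    (f c0)`_i = \sum_(ab : 'I_A * 'I_B) lam (ab, c0) * (i == (ab.1 + t * ab.2)%N)%:R.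
  by rewrite coef_sum; apply: eq_bigr => ab _; rewrite coefZ coefXn.
have f0 : f c0 = 0.
  apply: (sparse_poly_eq0 charFp (N := A * B)).
  - apply: leq_trans (size_sum _ _ _) _; apply/bigmax_leqP => -[a b] _ /=.
    apply: leq_trans (size_scale_leq _ _) _; rewrite size_polyXn.
    have : (t * b.+1 <= t * B)%N by rewrite leq_mul2l ltn_ord orbT.
    by have := ltn_ord a; rewrite mulnS; lia.
  - pose e (ab : 'I_A * 'I_B) := (ab.1 + t * ab.2)%N.
    have -> : (A * B = #|{: 'I_A * 'I_B}|)%N by rewrite card_prod !card_ord.
    rewrite !cardE -(size_map (val : 'I_p -> nat)) -(size_map e).
    apply: uniq_leq_size; first by rewrite map_inj_uniq ?enum_uniq //; apply: val_inj.
    move=> _ /mapP[i + ->]; rewrite mem_enum inE coef_f => nz_i.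
    have [ab /andP[lab /eqP ->]] : exists ab, (lam (ab, c0) != 0) && (val i == e ab).
      apply/existsP; apply: contraR nz_i => /existsPn no_ab.
      apply/eqP/big1 => ab _; have := no_ab ab; rewrite negb_and negbK.
      by case/orP => [/eqP -> | /negPf ->]; rewrite ?mul0r ?mulr0.
    by apply: map_f; rewrite mem_enum.
  - apply: dvdp_trans dvd_f0; exact: dvdp_exp2l.
have : (f c0)`_(a0 + t * b0) = lam (a0, b0, c0).
  rewrite coef_f (bigD1 (a0, b0)) //= eqxx mulr1 big1 ?addr0 // => -[a b] /= ne.
  case: eqP => [e|]; last by rewrite mulr0.
  have lt_a (a' : 'I_A) : (a' < t)%N := leq_trans (ltn_ord a') leAt.
  have t_gt0 : (0 < t)%N := leq_ltn_trans (leq0n _) (lt_a a).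
  have ea : a0 = a.
    apply: val_inj; have := congr1 (modn^~ t) e.
    by rewrite /= ![(_ + t * _)%N]addnC ![(t * _)%N]mulnC !modnMDl !modn_small.
  have eb : b0 = b.
    apply: val_inj; move/eqP: e; rewrite ea eqn_add2l eqn_pmul2l // => /eqP //.
  by rewrite ea eb eqxx in ne.
by rewrite f0 coef0 => e; rewrite -e eqxx in lam0.
Qed.

End Coefficients.

End AuxiliaryPolynomials.

Lemma dvdp_prod_exp_XsubC (F : finFieldType) (X : {set F}) (D : nat) (f : {poly F}) :
  (forall x, x \in X -> ('X - x%:P) ^+ D %| f) ->
  \prod_(x in X) ('X - x%:P) ^+ D %| f.
Proof.
move=> dvd_f; rewrite -big_enum /=; have := enum_uniq X.
have : all [in X] (enum X) by apply/allP => x; rewrite mem_enum.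
elim: (enum X) => [|x s IH] /=; first by rewrite big_nil dvd1p.
case/andP=> xX sX /andP[x_s uniq_s]; rewrite big_cons Gauss_dvdp ?IH ?dvd_f //.
rewrite big_seq; apply: (big_ind (fun g => coprimep _ g)) => [|g h|y y_s].
- exact: coprimep1.
- by rewrite coprimepMr => -> ->.
- apply/coprimep_expl/coprimep_expr/coprimep_XsubC2; rewrite subr_eq0.
  by apply: contraNneq x_s => <-.
Qed.


Section StepanovBound.

Variables (F : finFieldType) (p : nat).
Hypothesis charFp : p \in [pchar F].

(** Points x whose pair (x^t, (x - 1)^t) lies in Z are rare: with m = |Z| and the
    smallest admissible B, there are O((m t)^(2/3)) of them.  With A = t / B,
    vanishing to order A at all these points imposes at most m A (2 A) linear
    conditions on the A B^2 coefficients of the auxiliary polynomial, and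
    2 m A < B^2.  A nonzero solution has degree less than A + 2 t B, hence at
    most (A + 2 t B) / A zeros of order A. *)
Theorem stepanov (t B : nat) (Z : {set F * F}) :
  (B <= t)%N -> (t * B <= p)%N -> (2 * #|Z| * t < B ^ 3)%N ->
  (#|[set x : F | [&& x != 0, x != 1 & (x ^+ t, (x - 1) ^+ t) \in Z]%R]| <= 5 * B ^ 2)%N.
Proof.
move=> leBt letBp ltZB.
have B_gt0 : (0 < B)%N by rewrite lt0n; apply: contraTneq ltZB => ->.
have t_gt0 : (0 < t)%N := leq_trans B_gt0 leBt.
(* A is both the degree bound in the auxiliary polynomial and the order of vanishing. *)
pose A := (t %/ B)%N.
have A_gt0 : (0 < A)%N by rewrite divn_gt0.
have leABt : (A * B <= t)%N := leq_divM _ _.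
set X := finset _.
pose I : finType := ('I_A * 'I_B * 'I_B)%type.
pose J : finType := ({z : F * F | z \in Z} * 'I_A * 'I_(A + A))%type.
have card_JI : (#|J| < #|I|)%N.
  rewrite !card_prod !card_ord card_sig cardE -cardE.
  have -> : #|[pred z | z \in Z]| = #|Z| by apply: eq_card.
  nia.
pose c (i : I) (j : J) : F :=
  (iter j.1.2 (twisted_theta (t * i.1.2) (t * i.2)) 'X^(i.1.1))`_j.2
    * ((val j.1.1).1 ^+ i.1.2 * (val j.1.1).2 ^+ i.2).
have [lam lam_neq0 lam_sol] := underdetermined_system c card_JI.
pose f := aux_poly t lam.
have f_neq0 : f != 0 by apply: (aux_poly_neq0 charFp).
have vanish x : x \in X -> ('X - x%:P) ^+ A %| f.
  rewrite inE => /and3P[x0 x1 xZ]; apply: (dvdp_exp_theta charFp) => //.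
    apply: leq_trans letBp; apply: leq_trans (leq_pmulr _ B_gt0); exact: leq_div.
  move=> k ltkA; rewrite rootE /f /aux_poly iter_theta_sum horner_sum.
  under eq_bigr => i _ do rewrite iter_theta_twist hornerZ hornerM.
  have expand (i : I) :
      (iter k (twisted_theta (t * i.1.2) (t * i.2)) 'X^(i.1.1)).[x]
      = \sum_(l < A + A)
          (iter k (twisted_theta (t * i.1.2) (t * i.2)) 'X^(i.1.1))`_l * x ^+ l.
    apply: horner_coef_wide; apply: leq_trans (size_iter_twisted_theta _ _ _ _) _.
    by rewrite size_polyXn leq_add // ltnW.
  under eq_bigr => i _ do rewrite expand.
  pose z := Sub (x ^+ t, (x - 1) ^+ t) xZ : {z : F * F | z \in Z}.
  under eq_bigr => i _ do rewrite mulr_suml mulr_sumr.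
  rewrite exchange_big big1 //= => l _.
  have /(congr1 ( *%R (x ^+ l))) := lam_sol (z, Ordinal ltkA, l).
  rewrite mulr0 mulr_sumr => sol; apply: etrans sol; apply: eq_bigr => i _.
  rewrite /c /= hornerM hornerXn horner_exp hornerXsubC !exprM -!mulrA.
  by rewrite [RHS]mulrCA; congr (_ * _); rewrite [RHS]mulrCA.
have : (size (\prod_(x in X) ('X - x%:P) ^+ A)%R <= size f)%N.
  by apply: dvdp_leq f_neq0 _; apply: dvdp_prod_exp_XsubC.
have nz x : x \in X -> ('X - x%:P) ^+ A != 0 by rewrite expf_neq0 ?polyXsubC_eq0.
rewrite (size_prod nz) (eq_bigr (fun=> A.+1)) => [|x _]; last exact: size_exp_XsubC.
rewrite sum_nat_const; have := size_aux_poly t lam; rewrite -/f.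
have ltt : (t < (A + 1) * B)%N by rewrite addn1 -ltn_divLR.
move: #|X| => m.
have : (t * B <= 2 * A * B * B)%N by rewrite leq_mul2r; apply/orP; right; nia.
move=> h1 h2 h3.
have : (A * m <= A * (1 + 4 * B ^ 2))%N by nia.
rewrite leq_pmul2l // => h4; apply: leq_trans h4 _; nia.
Qed.

End StepanovBound.

(** * Representations by sums and differences of roots of unity *)

Section Cauchy.
Variable I : finType.

Lemma cauchy_schwarz_sum (R : realDomainType) (f g : I -> R) :
  (\sum_i f i * g i) ^+ 2 <= (\sum_i f i ^+ 2) * (\sum_i g i ^+ 2).
Proof.
rewrite -(ler_pM2l (ltr0Sn R 1)) -subr_ge0.
have -> : 2 * ((\sum_i f i ^+ 2) * (\sum_i g i ^+ 2)) - 2 * (\sum_i f i * g i) ^+ 2 =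
    \sum_i \sum_j (f i * g j - f j * g i) ^+ 2.
  have e1 : (\sum_i f i ^+ 2) * (\sum_i g i ^+ 2) = \sum_i \sum_j f i ^+ 2 * g j ^+ 2.
    by rewrite big_distrlr.
  have e2 : (\sum_i f i * g i) ^+ 2 = \sum_i \sum_j f i * g i * (f j * g j).
    by rewrite expr2 big_distrlr.
  have e3 : (\sum_i f i ^+ 2) * (\sum_i g i ^+ 2) = \sum_i \sum_j f j ^+ 2 * g i ^+ 2.
    by rewrite e1 exchange_big.
  rewrite [2 * (_ * _)]mulr_natl mulr2n {1}e1 e3 e2 mulr_sumr -big_split /= -sumrB.
  apply: eq_bigr => i _; rewrite mulr_sumr -big_split /= -sumrB.
  by apply: eq_bigr => j _; ring.
by apply: sumr_ge0 => i _; apply: sumr_ge0 => j _; apply: sqr_ge0.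
Qed.

Lemma sqr_sum_leq (f g : I -> nat) :
  ((\sum_i f i * g i) ^ 2 <= (\sum_i f i ^ 2) * (\sum_i g i ^ 2))%N.
Proof.
have := cauchy_schwarz_sum (fun i => (f i)%:R : int) (fun i => (g i)%:R).
rewrite -(ler_nat int) natrX natrM !natr_sum.
by congr (_ ^+ _ <= _ * _); apply: eq_bigr => i _; rewrite ?natrM ?natrX.
Qed.
End Cauchy.

Section Subgroup.

Variables (F : finFieldType) (t : nat).
Local Notation H := [set x : F | x ^+ t == 1].
Hypothesis card_H : #|H| = t.

(** Indicator of the group H of t-th roots of unity.  Its values are natural
    numbers, so that every count is a plain sum over the field and can be
    reindexed by translations and dilations. *)
Definition mu_ind (x : F) : nat := (x ^+ t == 1).
Definition diff_reps (d : F) : nat := (\sum_y mu_ind y * mu_ind (d + y)%R)%N.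
Definition sum_reps (x : F) : nat := (\sum_y mu_ind y * mu_ind (x - y)%R)%N.

Lemma mu_order_gt0 : (0 < t)%N.
Proof. by rewrite -card_H; apply/card_gt0P; exists 1; rewrite inE expr1n. Qed.

Lemma sum_mu_ind : (\sum_x mu_ind x = t)%N.
Proof. by apply: etrans card_H; rewrite -sum1_card [RHS]big_mkcond; apply: eq_bigr => x _;
  rewrite inE. Qed.

Lemma mu_ind_neq0 (x : F) : mu_ind x != 0%N -> x != 0.
Proof.
rewrite /mu_ind; case: (x =P 0) => // ->.
by rewrite expr0n (gtn_eqF mu_order_gt0) (eq_sym (0 : F)) oner_eq0.
Qed.

Lemma mu_indM (a x : F) : mu_ind a = 1%N -> mu_ind (a * x) = mu_ind x.
Proof. by rewrite /mu_ind exprMn; case: eqP => // -> _; rewrite mul1r. Qed.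

Lemma mu_ind_case (x : F) : mu_ind x = 0%N \/ mu_ind x = 1%N.
Proof. by rewrite /mu_ind; case: eqP; [right|left]. Qed.

Definition mu_invariant (g : F -> nat) := forall a x, mu_ind a = 1%N -> g (a * x) = g x.

Definition mu_stable (D : {set F}) :=
  0 \notin D /\ forall a d : F, mu_ind a = 1%N -> d \in D -> a * d \in D.

Lemma mu_stable_invariant (D : {set F}) : mu_stable D -> mu_invariant (fun d => d \in D : nat).
Proof.
move=> [_ stab] a x ha; congr (nat_of_bool _); apply/idP/idP; last exact: stab.
have a0 : a != 0 by apply: mu_ind_neq0; rewrite ha.
move=> axD; rewrite -(mulKf a0 x); apply: stab => //.
by move: ha; rewrite /mu_ind exprVn; case: eqP => // -> _; rewrite invr1 eqxx.
Qed.

Definition superlevel (g : F -> nat) (k : nat) : {set F} :=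
  [set x : F | (x != 0)%R && (k <= g x)%N].

Lemma superlevel_stable (g : F -> nat) (k : nat) :
  mu_invariant g -> mu_stable (superlevel g k).
Proof.
move=> g_inv; split; first by rewrite inE eqxx.
move=> a x ha; rewrite !inE g_inv // => /andP[x0 ->]; rewrite andbT mulf_neq0 //.
by apply: mu_ind_neq0; rewrite ha.
Qed.

Lemma card_superlevel_le (g : F -> nat) (k : nat) :
  (#|superlevel g k| * k <= \sum_(x in superlevel g k) g x)%N.
Proof.
by rewrite -sum_nat_const; apply: leq_sum => x; rewrite inE => /andP[].
Qed.

Lemma diff_reps_invariant : mu_invariant diff_reps.
Proof.
move=> a d ha; have a0 : a != 0 by apply: mu_ind_neq0; rewrite ha.
rewrite /diff_reps (reindex_inj (mulfI a0)); apply: eq_bigr => y _.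
by rewrite -mulrDr !mu_indM.
Qed.

Lemma sum_reps_invariant : mu_invariant sum_reps.
Proof.
move=> a x ha; have a0 : a != 0 by apply: mu_ind_neq0; rewrite ha.
rewrite /sum_reps (reindex_inj (mulfI a0)); apply: eq_bigr => y _.
by rewrite -mulrBr !mu_indM.
Qed.

Lemma sum_diff_reps (g : F -> nat) :
  (\sum_d diff_reps d * g d = \sum_x \sum_y mu_ind x * mu_ind y * g (x - y)%R)%N.
Proof.
rewrite /diff_reps; under eq_bigr => d _ do rewrite big_distrl /=.
rewrite exchange_big [RHS]exchange_big /=; apply: eq_bigr => y _.
rewrite (reindex_inj (addIr (- y))) /=; apply: eq_bigr => x _.
by rewrite subrK [(mu_ind y * _)%N]mulnC.
Qed.

Lemma sum_sum_reps (g : F -> nat) :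
  (\sum_x sum_reps x * g x = \sum_x \sum_y mu_ind x * mu_ind y * g (x + y)%R)%N.
Proof.
rewrite /sum_reps; under eq_bigr => d _ do rewrite big_distrl /=.
rewrite exchange_big [RHS]exchange_big /=; apply: eq_bigr => y _.
rewrite (reindex_inj (addIr y)) /=; apply: eq_bigr => x _.
by rewrite addrK [(mu_ind y * _)%N]mulnC.
Qed.

Lemma sum_diff_reps_all : (\sum_d diff_reps d = t ^ 2)%N.
Proof.
transitivity (\sum_d diff_reps d * 1)%N; first by apply: eq_bigr => d _; rewrite muln1.
rewrite (sum_diff_reps (fun=> 1%N)) -mulnn -sum_mu_ind big_distrlr /=.
by apply: eq_bigr => x _; apply: eq_bigr => y _; rewrite muln1.
Qed.

Lemma sum_sum_reps_all : (\sum_d sum_reps d = t ^ 2)%N.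
Proof.
transitivity (\sum_d sum_reps d * 1)%N; first by apply: eq_bigr => d _; rewrite muln1.
rewrite (sum_sum_reps (fun=> 1%N)) -mulnn -sum_mu_ind big_distrlr /=.
by apply: eq_bigr => x _; apply: eq_bigr => y _; rewrite muln1.
Qed.

Lemma diff_reps_le (d : F) : (diff_reps d <= t)%N.
Proof.
rewrite -sum_mu_ind; apply: leq_sum => y _.
by case: (mu_ind_case (d + y)) => ->; rewrite ?muln0 ?muln1.
Qed.

Lemma sum_reps_le (d : F) : (sum_reps d <= t)%N.
Proof.
rewrite -sum_mu_ind; apply: leq_sum => y _.
by case: (mu_ind_case (d - y)) => ->; rewrite ?muln0 ?muln1.
Qed.

(** By homogeneity a pair of elements of H may be scaled to (v, 1). *)
Lemma sum_diff_reps_invariant (g : F -> nat) : mu_invariant g ->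
  (\sum_d diff_reps d * g d = t * \sum_v mu_ind v * g (v - 1)%R)%N.
Proof.
move=> g_inv; rewrite sum_diff_reps exchange_big /= -[X in (X * _)%N]sum_mu_ind big_distrl /=.
apply: eq_bigr => y _; case: (mu_ind_case y) => hy; rewrite hy.
  by rewrite mul0n big1 // => x _; rewrite muln0 mul0n.
have y0 : y != 0 by apply: mu_ind_neq0; rewrite hy.
rewrite mul1n (reindex_inj (mulfI y0)) /=; apply: eq_bigr => v _.
by rewrite muln1 mu_indM // -{2}[y]mulr1 -mulrBr g_inv.
Qed.

Lemma sum_shift_invariant (g : F -> nat) (x : F) : mu_invariant g -> mu_ind x = 1%N ->
  (\sum_y mu_ind y * g (x + y)%R = \sum_v mu_ind v * g (1 + v)%R)%N.
Proof.
move=> g_inv hx; have x0 : x != 0 by apply: mu_ind_neq0; rewrite hx.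
rewrite (reindex_inj (mulfI x0)) /=; apply: eq_bigr => v _.
by rewrite mu_indM // -{1}[x]mulr1 -mulrDr g_inv.
Qed.

Lemma sum_sum_reps_invariant (g : F -> nat) : mu_invariant g ->
  (\sum_d sum_reps d * g d = t * \sum_v mu_ind v * g (1 + v)%R)%N.
Proof.
move=> g_inv; rewrite sum_sum_reps -[X in (X * _)%N]sum_mu_ind big_distrl /=.
apply: eq_bigr => x _; case: (mu_ind_case x) => hx; rewrite hx.
  by rewrite mul0n big1.
rewrite mul1n -(sum_shift_invariant g_inv hx); apply: eq_bigr => v _.
by rewrite mul1n.
Qed.

(** Both sides count the solutions of x + y = x' + y' in H, the left one in the
    form x - x' = y' - y. *)
Lemma diff_energy_eq_sum_energy : (\sum_d diff_reps d ^ 2 = \sum_x sum_reps x ^ 2)%N.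
Proof.
have -> : (\sum_x sum_reps x ^ 2 = \sum_x sum_reps x * sum_reps x)%N
  by apply: eq_bigr => x _; rewrite mulnn.
have -> : (\sum_x diff_reps x ^ 2 = \sum_x diff_reps x * diff_reps x)%N
  by apply: eq_bigr => x _; rewrite mulnn.
rewrite sum_sum_reps sum_diff_reps.
under eq_bigr => a _ do under eq_bigr => y _ do rewrite /diff_reps big_distrr /=.
under [RHS]eq_bigr => a _ do under eq_bigr => y _ do rewrite /sum_reps big_distrr /=.
apply: eq_bigr => a _; rewrite exchange_big; apply: eq_bigr => y' _.
apply: eq_bigr => y _.
rewrite addrAC [(a + y' - _)%R]addrAC; ring.
Qed.

End Subgroup.

(** Supplies the parameter B of [stepanov] within a constant factor of the optimum. *)
Lemma exists_cube (N : nat) : (0 < N)%N ->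
  exists B, (N < B ^ 3)%N /\ (B ^ 3 <= 8 * N)%N.
Proof.
move=> N_gt0; have ex : exists B, (N < B ^ 3)%N.
  exists N.+1; apply: leq_trans (ltnSn N) _.
  by rewrite -{1}[N.+1]expn1 leq_pexp2l.
have [B ltNB minB] := ex_minnP ex; exists B; split=> //.
case: B ltNB minB => [//|B] ltNB minB.
have leBN : (B ^ 3 <= N)%N.
  by rewrite leqNgt; apply/negP => /minB; rewrite ltnn.
have [B0|B_gt0] := posnP B; first by rewrite B0 in ltNB; lia.
nia.
Qed.

Section StepanovSubgroup.

Variables (F : finFieldType) (p t : nat).
Hypothesis charFp : p \in [pchar F].
Local Notation H := [set x : F | x ^+ t == 1].
Hypothesis card_H : #|H| = t.
Local Notation mu_ind := (mu_ind t).
Local Notation mu_stable := (mu_stable t).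
Local Notation diff_reps := (@diff_reps F t).

(** A stable set is a union of cosets of H, and x |-> x^t separates the cosets. *)
Lemma card_imset_exp (D : {set F}) : mu_stable D ->
  (#|[set d ^+ t | d in D]%R| * t <= #|D|)%N.
Proof.
case=> D0 stab; rewrite -[X in (_ <= X)%N]sum1_card.
rewrite (partition_big_imset (fun d : F => d ^+ t)) /= -sum_nat_const.
apply: leq_sum => _ /imsetP[d dD ->].
have d0 : d != 0 by apply: contraNneq D0 => <-.
rewrite -{1}card_H -(card_imset _ (mulIf d0)) sum1dep_card.
apply: subset_leq_card; apply/fintype.subsetP => _ /imsetP[a + ->].
rewrite !inE => aH; rewrite stab //=; last by rewrite /mu_ind aH.
by rewrite exprMn (eqP aH) mul1r.
Qed.

(** Stepanov's bound for the pairs (1, c), one for each coset in D. *)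
Lemma mu_shift_in_stable (D : {set F}) (B : nat) : mu_stable D ->
  (B <= t)%N -> (t * B <= p)%N -> (2 * #|D| < B ^ 3)%N ->
  (\sum_v mu_ind v * ((v - 1)%R \in D) <= 5 * B ^ 2)%N.
Proof.
move=> stabD leBt letBp ltDB.
pose Z : {set F * F} := [set (1%R, c) | c in [set d ^+ t | d in D]%R].
have cardZ : (#|Z| * t <= #|D|)%N.
  apply: leq_trans (card_imset_exp stabD); rewrite leq_mul2r.
  by rewrite leq_imset_card orbT.
have ltZB : (2 * #|Z| * t < B ^ 3)%N by nia.
apply: leq_trans (stepanov charFp leBt letBp ltZB).
rewrite -sum1_card [X in (_ <= X)%N]big_mkcond /=; apply: leq_sum => v _.
case: (mu_ind_case t v) => hv; rewrite hv ?mul0n // mul1n.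
case vD: (v - 1 \in D) => //; rewrite inE.
have v0 : v != 0 by apply: (mu_ind_neq0 card_H); rewrite hv.
have v1 : v != 1 by rewrite -subr_eq0; apply: contraNneq stabD.1 => <-.
rewrite v0 v1 /=; suff -> : (v ^+ t, (v - 1) ^+ t) \in Z by [].
move: hv; rewrite /mu_ind; case: eqP => // -> _.
by apply: imset_f; apply: imset_f.
Qed.

(** After division by d the pair (a, a - d) becomes (x, x - 1), whose t-th powers
    lie in a set of size at most (|P| / t)^2. *)
Lemma card_stable_differences (P : {set F}) (d : F) (B : nat) : mu_stable P -> d != 0 ->
  (B <= t)%N -> (t * B <= p)%N -> (2 * #|P| ^ 2 < t * B ^ 3)%N ->
  (#|[set a in P | (a - d)%R \in P]| <= 5 * B ^ 2)%N.
Proof.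
move=> stabP d0 leBt letBp ltPB.
pose Z1 : {set F} := [set c / d ^+ t | c in [set a ^+ t | a in P]]%R.
have cardZ1 : (#|Z1| * t <= #|P|)%N.
  apply: leq_trans (card_imset_exp stabP); rewrite leq_mul2r.
  by rewrite leq_imset_card orbT.
have t0 := mu_order_gt0 card_H.
have ltZB : (2 * #|finset.setX Z1 Z1| * t < B ^ 3)%N.
  rewrite finset.cardsX -(ltn_pmul2l t0); apply: leq_ltn_trans ltPB.
  have := leq_mul cardZ1 cardZ1; nia.
apply: leq_trans (stepanov charFp leBt letBp ltZB).
have inj_d : injective (fun a : F => a / d) by apply: mulIf; rewrite invr_neq0.
rewrite -(card_imset _ inj_d); apply: subset_leq_card.
apply/fintype.subsetP => _ /imsetP[a + ->]; rewrite !inE => /andP[aP adP].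
have a0 : a != 0 by apply: contraNneq stabP.1 => <-.
have ad0 : a - d != 0 by apply: contraNneq stabP.1 => <-.
have -> : a / d - 1 = (a - d) / d by rewrite mulrBl divff.
rewrite mulf_neq0 ?invr_neq0 //= !expr_div_n.
rewrite -subr_eq0 (_ : a / d - 1 = (a - d) / d); last by rewrite mulrBl divff.
by rewrite mulf_neq0 ?invr_neq0 //=; apply/andP; split; apply: imset_f; apply: imset_f.
Qed.

(** For D the set of differences with at least k representations,
    k |D| <= t O(B^2) where B^3 is about |D|; this is |D| k^3 = O(t^3). *)
Lemma card_superlevel_diff_reps (k : nat) : (0 < k)%N -> (16 <= t)%N ->
  (16 * t ^ 5 <= p ^ 3)%N ->
  (#|superlevel diff_reps k| * k ^ 3 <= 2 ^ 15 * t ^ 3)%N.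
Proof.
move=> k_gt0 t16 t5p; set D := superlevel diff_reps k.
have stabD : mu_stable D := superlevel_stable card_H k (diff_reps_invariant card_H).
have [->|D_gt0] := posnP #|D|; first by rewrite mul0n.
have leD : (#|D| * k <= \sum_d diff_reps d * (d \in D))%N.
  apply: leq_trans (card_superlevel_le _ _) _; rewrite big_mkcond; apply: leq_sum => d _.
  by rewrite -/D; case: (d \in D); rewrite ?muln1.
have leDt : (#|D| <= t ^ 2)%N.
  apply: leq_trans (leq_pmulr _ k_gt0) _; apply: leq_trans leD _.
  rewrite -(sum_diff_reps_all card_H); apply: leq_sum => d _.
  by case: (d \in D); rewrite ?muln1 ?muln0.
have [B [ltB leB]] := @exists_cube (2 * #|D|)%N ltac:(by rewrite muln_gt0).
have leBt : (B <= t)%N.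
  have : (B ^ 3 <= t ^ 3)%N by apply: leq_trans leB _; nia.
  by rewrite leq_exp2r.
have letBp : (t * B <= p)%N.
  have : ((t * B) ^ 3 <= p ^ 3)%N.
    rewrite expnMn; apply: leq_trans t5p.
    by apply: leq_trans (leq_mul (leqnn _) leB) _; nia.
  by rewrite leq_exp2r.
have := mu_shift_in_stable stabD leBt letBp ltB.
have inv := mu_stable_invariant card_H stabD.
rewrite -(leq_pmul2l (mu_order_gt0 card_H)) -(sum_diff_reps_invariant card_H inv) =>
  /(leq_trans leD).
move: #|D| leB D_gt0 => m leB m0 le1.
have : ((m * k) ^ 3 <= (t * (5 * B ^ 2)) ^ 3)%N by rewrite leq_exp2r.
have -> : ((t * (5 * B ^ 2)) ^ 3 = 125 * t ^ 3 * (B ^ 3 * B ^ 3))%N by ring.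
move=> le2; have le3 := leq_trans le2 (leq_mul (leqnn _) (leq_mul leB leB)).
rewrite -(leq_pmul2l (_ : 0 < m ^ 2)%N) ?expn_gt0 ?m0 //.
apply: leq_trans (leq_trans _ le3) _; first by apply/eq_leq; ring.
rewrite (_ : (2 ^ 15 = 128 * 256)%N) //; nia.
Qed.

(** The previous bound makes every dyadic range of values contribute O(t^3); the
    difference 0 contributes t^3 by itself. *)
Lemma sum_diff_reps_cube : (16 <= t)%N -> (16 * t ^ 5 <= p ^ 3)%N ->
  (\sum_(d : F) diff_reps d ^ 3 <= 2 ^ 19 * t ^ 3 * (trunc_log 2 t).+1)%N.
Proof.
move=> t16 t5p; set l := trunc_log 2 t.
have le_layers (d : F) : d != 0 ->
    (diff_reps d ^ 3 <= \sum_(j < l.+1) 8 * (2 ^ j) ^ 3 *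
      (d \in superlevel diff_reps (2 ^ j)))%N.
  move=> d0; have [->|reps_gt0] := posnP (diff_reps d); first by rewrite exp0n.
  have ltj : (trunc_log 2 (diff_reps d) < l.+1)%N.
    rewrite ltnS; apply: leq_trunc_log; exact: (diff_reps_le card_H).
  rewrite (bigD1 (Ordinal ltj)) //= inE d0 /=; apply: leq_trans (leq_addr _ _).
  have /andP[-> /ltnW le2] := trunc_log_bounds (isT : 1 < 2)%N reps_gt0.
  by rewrite muln1 -[8%N]/(2 ^ 3)%N -expnMn -expnS leq_exp2r.
rewrite (bigD1 (0%R : F)) //=.
have le0 : (diff_reps (0%R : F) ^ 3 <= t ^ 3)%N by rewrite leq_exp2r // (diff_reps_le card_H).
have le1 : (\sum_(d : F | (d != 0)%R) diff_reps d ^ 3 <= 2 ^ 18 * t ^ 3 * l.+1)%N.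
  apply: (@leq_trans (\sum_(d : F) \sum_(j < l.+1) 8 * (2 ^ j) ^ 3 *
    (d \in superlevel diff_reps (2 ^ j)))%N).
    by rewrite big_mkcond /=; apply: leq_sum => d _; case: ifP => // /le_layers.
  rewrite exchange_big /=.
  apply: (@leq_trans (\sum_(j < l.+1) 2 ^ 18 * t ^ 3)%N); last first.
    by rewrite sum_nat_const card_ord mulnC.
  apply: leq_sum => j _; rewrite -big_distrr /=.
  have -> : (\sum_d (d \in superlevel diff_reps (2 ^ j)) = #|superlevel diff_reps (2 ^ j)|)%N.
    by rewrite -sum1_card [RHS]big_mkcond; apply: eq_bigr => d _; case: (d \in _).
  have := @card_superlevel_diff_reps (2 ^ j) (expn_gt0 2 j) t16 t5p.
  rewrite -mulnA [(_ * #|_|)%N]mulnC => le_j.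
  have e18 : (2 ^ 18 = 2 ^ 3 * 2 ^ 15)%N := expnD 2 3 15.
  by rewrite e18 -[(_ * _ * t ^ 3)%N]mulnA leq_mul2l le_j orbT.
apply: leq_trans (leq_add le0 le1) _; rewrite (expnS 2 18).
have : (0 < 2 ^ 18)%N by rewrite expn_gt0.
move: (2 ^ 18)%N => c c0; nia.
Qed.
End StepanovSubgroup.

(** * Popular sums *)

Section PopularSums.

Variables (F : finFieldType) (p t : nat).
Hypothesis charFp : p \in [pchar F].
Local Notation H := [set x : F | x ^+ t == 1].
Hypothesis card_H : #|H| = t.
Local Notation mu_ind := (mu_ind t).
Local Notation diff_reps := (@diff_reps F t).
Local Notation sum_reps := (@sum_reps F t).

Definition centres (a b : F) : nat :=
  (\sum_y mu_ind y * mu_ind (a - y)%R * mu_ind (b - y)%R)%N.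

(** Both sides count the triples of pairs of H with a common difference: two
    centres y, y' of the same (a, b) give y - y' = (a - y') - (a - y) =
    (b - y') - (b - y). *)
Lemma sum_centres_sqr : (\sum_(d : F) \sum_a centres a (a - d)%R ^ 2 =
  \sum_(d : F) diff_reps d ^ 3)%N.
Proof.
have sum_shifted_pairs (y y' : F) : (\sum_a mu_ind (a - y)%R * mu_ind (a - y')%R)%N =
  diff_reps (y - y').
  rewrite (reindex_inj (addIr y)) /=; apply: eq_bigr => a _.
  by rewrite addrK -addrA [(a + _)%R]addrC.
have -> : (\sum_(d : F) diff_reps d ^ 3 = \sum_(d : F) diff_reps d * diff_reps d ^ 2)%N.
  by apply: eq_bigr => d _; rewrite expnS.
rewrite sum_diff_reps exchange_big /=.
transitivity (\sum_(a : F) \sum_b centres a b ^ 2)%N.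
  apply: eq_bigr => a _; rewrite (reindex_inj (inj_comp (addrI a) oppr_inj)) /=.
  by apply: eq_bigr => b _; rewrite opprD opprK addrA subrr add0r.
transitivity (\sum_(a : F) \sum_(b : F) \sum_(y : F) \sum_(y' : F)
   (mu_ind y * mu_ind y' * (mu_ind (a - y)%R * mu_ind (a - y')%R) *
     (mu_ind (b - y)%R * mu_ind (b - y')%R)))%N.
  apply: eq_bigr => a _; apply: eq_bigr => b _.
  rewrite -mulnn big_distrlr /=; apply: eq_bigr => y _; apply: eq_bigr => y' _; ring.
under [LHS]eq_bigr => a _ do rewrite exchange_big /=.
rewrite [LHS]exchange_big /=; apply: eq_bigr => y _.
under [LHS]eq_bigr => a _ do rewrite exchange_big /=.
rewrite [LHS]exchange_big /=; apply: eq_bigr => y' _.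
under [LHS]eq_bigr => a _ do rewrite -big_distrr /= sum_shifted_pairs.
by rewrite -big_distrl -big_distrr /= sum_shifted_pairs -mulnA mulnn.
Qed.

Section Dense.

Variables (P : {set F}) (u : nat).
Local Notation g x := (nat_of_bool (x \in P)).
Hypothesis sum_P : forall x, mu_ind x = 1%N -> (\sum_y mu_ind y * g (x + y)%R = u)%N.

(** The number of (x, z, y) in H^3 with x - z = d and x + y, z + y in P, arranged
    by the pair (a, a - d) = (x + y, z + y). *)
Definition triples (d : F) : nat := (\sum_a g a * g (a - d)%R * centres a (a - d)%R)%N.

(** For fixed x and z, at most t - u elements y of H have x + y outside P, and
    likewise for z, hence at least 2 u - t elements y are good for both. *)
Lemma triples_ge (d : F) : (2 * u * diff_reps d <= triples d + t * diff_reps d)%N.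
Proof.
have -> : (triples d = \sum_z mu_ind z * mu_ind (d + z)%R *
     \sum_y mu_ind y * (g (d + z + y)%R * g (z + y)%R))%N.
  rewrite /triples /centres.
  under eq_bigr => a _ do rewrite big_distrr /=.
  under [RHS]eq_bigr => a _ do rewrite big_distrr /=.
  rewrite exchange_big [RHS]exchange_big /=; apply: eq_bigr => y _.
  rewrite (reindex_inj (addrI (d + y))) /=; apply: eq_bigr => z _.
  rewrite (_ : d + y + z - d = z + y); last by ring.
  rewrite (_ : d + y + z - y = d + z); last by ring.
  rewrite (_ : z + y - y = z); last by ring.
  rewrite (_ : d + y + z = d + z + y); last by ring.
  ring.
rewrite /diff_reps !big_distrr -big_split /=; apply: leq_sum => z _.
case: (mu_ind_case t z) => hz; rewrite hz ?mul0n ?muln0 //.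
case: (mu_ind_case t (d + z)) => hdz; rewrite hdz ?mul0n ?muln0 //.
rewrite !muln1 mul1n -{2}(sum_mu_ind card_H) mul2n -addnn -{1}(sum_P hdz) -(sum_P hz).
rewrite -!big_split /=; apply: leq_sum => y _.
case: (mu_ind_case t y) => ->; rewrite ?mul0n // !mul1n.
by case: (_ \in P); case: (_ \in P).
Qed.

Lemma triples_sqr_le (d : F) (M : nat) : (#|[set a in P | (a - d)%R \in P]| <= M)%N ->
  (triples d ^ 2 <= M * \sum_a centres a (a - d)%R ^ 2)%N.
Proof.
move=> leM; apply: leq_trans (sqr_sum_leq _ _) _; rewrite leq_mul2r; apply/orP; right.
apply: leq_trans leM; rewrite -sum1_card [X in (_ <= X)%N]big_mkcond /=.
by apply: leq_sum => a _; rewrite inE; case: (a \in P); case: (_ \in P).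
Qed.

(** Here M bounds the number of pairs in P at distance d.  Each nonzero d has at
    least (4/5) t r(d) triples, spread over at most M pairs; squaring, Cauchy-Schwarz
    and summation over d compare the energy with the third moment of r.  The term
    64 t^4 accounts for d = 0. *)
Lemma dense_sums_energy (M : nat) :
  (9 * t <= 10 * u)%N ->
  (forall d : F, (d != 0)%R -> #|[set a in P | (a - d)%R \in P]| <= M)%N ->
  (64 * t ^ 2 * \sum_(d : F) diff_reps d ^ 2 <=
     64 * t ^ 4 + 100 * M * \sum_(d : F) diff_reps d ^ 3)%N.
Proof.
move=> le_tu leM.
rewrite (bigD1 (0%R : F)) //= mulnDr; apply: leq_add.
  have := diff_reps_le card_H (0%R : F); rewrite -(@leq_exp2r _ _ 2) // => le0.
  by apply: leq_trans (leq_mul (leqnn _) le0) _; rewrite -mulnA -expnD.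
rewrite -sum_centres_sqr -[(100 * M * _)%N]mulnA !big_distrr /= [X in (X <= _)%N]big_mkcond /=.
apply: leq_sum => d _; case: ifP => // d0.
apply: (@leq_trans (100 * triples d ^ 2)); last by rewrite leq_mul2l triples_sqr_le ?orbT ?leM.
have := triples_ge d; move: (triples d) (diff_reps d) => T r le1.
have : ((8 * t * r) ^ 2 <= (10 * T) ^ 2)%N by rewrite leq_exp2r //; nia.
rewrite !expnMn; apply: leq_trans; apply/eq_leq; ring.
Qed.

End Dense.

Local Notation popular := (superlevel sum_reps).

(** If the popular sums carry at least 9/10 of all pairs, they alone make the
    energy at least (9/10) tau t^2. *)
Lemma popular_sums_energy (tau B : nat) :
  (9 * t ^ 2 <= 10 * \sum_(x in popular tau) sum_reps x)%N ->
  (B <= t)%N -> (t * B <= p)%N -> (2 * #|popular tau| ^ 2 < t * B ^ 3)%N ->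
  (64 * 9 * tau * t ^ 4 <=
    10 * (64 * t ^ 4 + 100 * 5 * B ^ 2 * \sum_(d : F) diff_reps d ^ 3))%N.
Proof.
move=> denseP leBt letBp ltPB; set P := popular tau in denseP ltPB *.
have stabP : mu_stable t P := superlevel_stable card_H tau (sum_reps_invariant card_H).
have invP := mu_stable_invariant card_H stabP.
pose u := (\sum_v mu_ind v * ((1 + v)%R \in P))%N.
have sumP : (\sum_(x in P) sum_reps x = t * u)%N.
  rewrite -(sum_sum_reps_invariant card_H invP) big_mkcond; apply: eq_bigr => x _.
  by case: (x \in P); rewrite ?muln1 ?muln0.
have le_tu : (9 * t <= 10 * u)%N.
  by rewrite -(leq_pmul2l (mu_order_gt0 card_H)); move: denseP; rewrite sumP; lia.
have sum_shift x : mu_ind x = 1%N -> (\sum_y mu_ind y * ((x + y)%R \in P) = u)%N.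
  exact: sum_shift_invariant invP.
have leM d : d != 0 -> (#|[set a in P | (a - d)%R \in P]| <= 5 * B ^ 2)%N.
  by move=> d0; apply: (card_stable_differences charFp card_H stabP).
have := dense_sums_energy sum_shift le_tu leM.
rewrite diff_energy_eq_sum_energy mulnA; set E3 := (\sum_(d : F) diff_reps d ^ 3)%N.
set E := (\sum_x _ ^ 2)%N => le1.
have le2 : (tau * (9 * t ^ 2) <= 10 * E)%N.
  apply: leq_trans (leq_mul (leqnn tau) denseP) _.
  rewrite mulnCA leq_mul2l /= big_distrr /= big_mkcond /=; apply: leq_sum => x _.
  by case: ifP => //; rewrite inE => /andP[_ le_tau]; rewrite -mulnn leq_mul2r le_tau orbT.
apply: leq_trans (leq_mul (leqnn 10) le1).
have := leq_mul (leqnn (64 * t ^ 2)) le2.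
by congr (_ <= _)%N; ring.
Qed.

End PopularSums.

Section FewPopularSums.

Variables (F : finFieldType) (p t : nat).
Hypothesis charFp : p \in [pchar F].
Local Notation H := [set x : F | x ^+ t == 1].
Hypothesis card_H : #|H| = t.
Local Notation sum_reps := (@sum_reps F t).

(** Otherwise [popular_sums_energy] would give tau t = O(B^2 log t) with
    B^3 = O(t^3 / tau^2), that is tau^7 = O(t^3 log^3 t).  The bound on t^5 is
    only required when tau <= t, since there are no popular sums for larger tau. *)
Lemma few_popular_sums (tau : nat) :
  (16 <= t)%N -> (5 <= tau)%N -> ((tau <= t)%N -> (16 * t ^ 5 <= p ^ 3)%N) ->
  (24 * t ^ 6 <= p ^ 3 * tau ^ 2)%N ->
  (2 ^ 79 * t ^ 3 * (trunc_log 2 t).+1 ^ 3 < tau ^ 7)%N ->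
  (10 * \sum_(x in superlevel sum_reps tau) sum_reps x < 9 * t ^ 2)%N.
Proof.
move=> t16 tau5 t5p t6p; apply: contraTltn => denseP; rewrite -leqNgt.
have t0 := mu_order_gt0 card_H.
set P := superlevel sum_reps tau in denseP.
have [x xP] : exists x, x \in P.
  apply/set0Pn/negP => /eqP P0; move: denseP; rewrite P0 big_set0; nia.
have le_tau : (tau <= t)%N.
  by move: xP; rewrite inE => /andP[_] /leq_trans; apply; apply: sum_reps_le card_H _.
have {}t5p := t5p le_tau.
have stabP : mu_stable t P := superlevel_stable card_H tau (sum_reps_invariant card_H).
have le_tP : (t <= #|P|)%N.
  apply: leq_trans (card_imset_exp card_H stabP); rewrite leq_pmull //.
  by apply/card_gt0P; exists (x ^+ t); apply: imset_f.
have le_Pt : (#|P| * tau <= t ^ 2)%N.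
  apply: leq_trans (card_superlevel_le _ _) _; rewrite -(sum_sum_reps_all card_H).
  by rewrite big_mkcond; apply: leq_sum => y _; case: ifP.
(* B^3 is of the order of |P|^2 / t, the least value allowed by [card_stable_differences]. *)
have [B [ltB leB]] := @exists_cube (2 * #|P| ^ 2 %/ t).+1 isT.
have ltPB : (2 * #|P| ^ 2 < t * B ^ 3)%N.
  by rewrite [(t * _)%N]mulnC -ltn_divLR //; apply: ltnW.
have leBP : (t * B ^ 3 <= 24 * #|P| ^ 2)%N.
  have := leq_divM (2 * #|P| ^ 2) t; nia.
have leBtau : (B ^ 3 * tau ^ 2 <= 24 * t ^ 3)%N by nia.
have leBt : (B <= t)%N.
  rewrite -(@leq_exp2r _ _ 3) // -(leq_pmul2r (isT : 0 < 24)%N).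
  rewrite [(t ^ 3 * _)%N]mulnC; apply: leq_trans leBtau; rewrite leq_mul2l; nia.
have letBp : (t * B <= p)%N.
  rewrite -(@leq_exp2r _ _ 3) // expnMn -(leq_pmul2r (_ : 0 < tau ^ 2)%N); last by nia.
  apply: leq_trans t6p; nia.
have := popular_sums_energy charFp card_H denseP leBt letBp ltPB.
have := sum_diff_reps_cube charFp card_H t16 t5p.
set E3 := (\sum_(d : F) _)%N; set l := (trunc_log 2 t).+1.
have e19 : (2 ^ 23 = 2 ^ 4 * 2 ^ 19)%N := expnD 2 4 19.
have pow79 (b : nat) : (b ^ 79 = b ^ 10 * (b ^ 23) ^ 3)%N by rewrite -expnM -expnD.
rewrite pow79; move: (2 ^ 23)%N (2 ^ 19)%N e19 => c c' -> le_E3 le_E.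
have le_tB : (tau * t <= 2 ^ 4 * c' * B ^ 2 * l)%N.
  rewrite -(@leq_pmul2l (448 * t ^ 3)); last by rewrite muln_gt0 expn_gt0 t0.
  have le1 := leq_mul (leqnn (B ^ 2)) le_E3.
  have le2 := leq_mul (leqnn (128 * t ^ 4)) tau5.
  have e1 : (B ^ 2 * (c' * t ^ 3 * l) = t ^ 3 * (c' * B ^ 2 * l))%N by ring.
  have e2 : (448 * t ^ 3 * (tau * t) = 448 * (tau * t ^ 4))%N by ring.
  have e3 : (448 * t ^ 3 * (2 ^ 4 * c' * B ^ 2 * l) =
    7 * 1024 * (t ^ 3 * (c' * B ^ 2 * l)))%N by ring.
  have e4 : (64 * 9 * tau * t ^ 4 = 576 * (tau * t ^ 4))%N by ring.
  have e5 : (128 * t ^ 4 * tau = 128 * (tau * t ^ 4))%N by ring.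
  have e6 : (10 * (64 * t ^ 4 + 100 * 5 * B ^ 2 * E3) =
    640 * t ^ 4 + 5 * 1000 * (B ^ 2 * E3))%N by ring.
  rewrite e1 in le1; rewrite e2 e3; rewrite e4 e6 in le_E; rewrite e5 in le2.
  move: (B ^ 2 * E3)%N (tau * t ^ 4)%N (t ^ 4)%N (t ^ 3 * _)%N le1 le2 le_E => a1 a2 a3 a4.
  lia.
have le_cube : ((tau * t) ^ 3 <= (2 ^ 4 * c' * B ^ 2 * l) ^ 3)%N by rewrite leq_exp2r.
have le_sqr := leq_mul leBtau leBtau.
rewrite -(@leq_pmul2l (t ^ 3)); last by rewrite expn_gt0 t0.
have := leq_mul le_cube (leqnn (tau ^ 4)).
have := leq_mul (leqnn ((2 ^ 4 * c' * l) ^ 3)) le_sqr.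
move: (2 ^ 4 * c')%N => c''.
have -> : ((c'' * l) ^ 3 * (B ^ 3 * tau ^ 2 * (B ^ 3 * tau ^ 2)) =
  (c'' * B ^ 2 * l) ^ 3 * tau ^ 4)%N by ring.
have -> : ((tau * t) ^ 3 * tau ^ 4 = t ^ 3 * tau ^ 7)%N by ring.
move=> h1 h2; apply: leq_trans (leq_trans h2 h1) _.
have -> : ((c'' * l) ^ 3 * (24 * t ^ 3 * (24 * t ^ 3)) =
  576 * ((c'' * l) ^ 3 * t ^ 6))%N by ring.
have -> : (t ^ 3 * (2 ^ 10 * c'' ^ 3 * t ^ 3 * l ^ 3) =
  1024 * ((c'' * l) ^ 3 * t ^ 6))%N by ring.
by rewrite leq_mul2r orbT.
Qed.
End FewPopularSums.

(** * Equidistribution of shifts of H in cosets *)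

Lemma expf_card_pred (F : finFieldType) (g : F) : g != 0 -> g ^+ #|F|.-1 = 1.
Proof.
move=> g0; apply: (mulfI g0); rewrite mulr1 -exprS prednK ?expf_card //.
by rewrite ltnW // finNzRing_gt1.
Qed.

Lemma card_unity_roots (F : finFieldType) (k : nat) :
  (0 < k)%N -> (#|[set z : F | (z ^+ k == 1)%R]| <= k)%N.
Proof.
move=> k_gt0; rewrite cardE; apply: max_unity_roots (enum_uniq _) => //.
by apply/allP => z; rewrite mem_enum inE => /eqP zk; apply/unity_rootP.
Qed.

Section Equidistribution.

Variables (F : finFieldType) (t d e : nat).
Local Notation H := [set x : F | x ^+ t == 1].
Hypothesis card_H : #|H| = t.
Hypothesis card_F : #|F| = (d * e).+1.
Hypothesis d_gt0 : (0 < d)%N.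
Hypothesis e_gt0 : (0 < e)%N.
Local Notation mu_ind := (mu_ind t).

(** The cosets of the subgroup K of order e are the fibres of g |-> g^e, and z
    ranges over the d-th roots of unity; z = 1 is K itself. *)
Definition coset_count (z x : F) : nat :=
  (\sum_y mu_ind y * ((x + y) ^+ e == z)%R)%N.

Let V := [set z : F | z ^+ d == 1].

Lemma sum_coset_indicator (g g' : F) :
  (\sum_(z in V) (g ^+ e == z) * (g' ^+ e == z) = (g != 0%R) && (g ^+ e == g' ^+ e)%R)%N.
Proof.
have [->|g0] := eqVneq g 0.
  rewrite big1 // => z; rewrite inE expr0n (gtn_eqF e_gt0) => zd.
  case: eqP => // z0; move: zd; rewrite -z0 expr0n (gtn_eqF d_gt0).
  by rewrite (eq_sym (0%R : F)) oner_eq0.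
have gV : g ^+ e \in V by rewrite inE -exprM mulnC -(expf_card_pred g0) card_F.
rewrite (bigD1 (g ^+ e)) //= eqxx mul1n big1 ?addn0; first by rewrite eq_sym.
by move=> z /andP[_]; rewrite eq_sym => /negPf ->.
Qed.

Lemma sum_translate_neq0 (y : F) : (\sum_x ((x + y)%R != 0%R) = d * e)%N.
Proof.
rewrite -[RHS]/((d * e).+1.-1) -card_F (cardD1 (- y)) inE /= -sum1_card [RHS]big_mkcond /=.
by apply: eq_bigr => x _; rewrite !inE andbT addr_eq0; case: eqP.
Qed.

Lemma sum_coset_count : (\sum_(z in V) \sum_x coset_count z x = t * (d * e))%N.
Proof.
rewrite /coset_count exchange_big /=.
under eq_bigr => x _ do rewrite exchange_big /=.
rewrite exchange_big /= -[X in (X * _)%N](sum_mu_ind card_H) big_distrl /=.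
apply: eq_bigr => y _; rewrite -(sum_translate_neq0 y) big_distrr /=.
apply: eq_bigr => x _; rewrite -big_distrr /=; congr (_ * _)%N.
transitivity (\sum_(z in V) ((x + y) ^+ e == z)%R * ((x + y) ^+ e == z)%R)%N.
  by apply: eq_bigr => z _; case: eqP.
by rewrite sum_coset_indicator eqxx andbT.
Qed.

(** The ratio (x + y) / (x + y') is an injective function of x that avoids 1 and
    is an e-th root of unity when the two e-th powers agree. *)
Lemma equal_powers_count (y y' : F) : y != y' ->
  (\sum_x (((x + y)%R != 0%R) && ((x + y) ^+ e == (x + y') ^+ e)%R) <= e.-1)%N.
Proof.
move=> ne_y; pose P (x : F) := (x + y != 0) && ((x + y) ^+ e == (x + y') ^+ e).
change (\sum_x P x <= e.-1)%N.
have -> : (\sum_x P x)%N = #|[set x | P x]|.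
  by rewrite -sum1_card [RHS]big_mkcond; apply: eq_bigr => x _; rewrite inE; case: (P x).
have nz' x : P x -> (x + y' != 0)%R.
  case/andP => xy0; apply: contraTneq => ->.
  by rewrite expr0n (gtn_eqF e_gt0) expf_eq0 e_gt0.
rewrite -(card_in_imset (f := fun x : F => (x + y) / (x + y'))); last first.
  move=> x1 x2; rewrite !inE => /nz' nz1 /nz' nz2 /eqP.
  rewrite eqr_div // -subr_eq0.
  have -> : (x1 + y) * (x2 + y') - (x2 + y) * (x1 + y') = (y' - y) * (x1 - x2) by ring.
  by rewrite mulf_eq0 !subr_eq0 eq_sym (negPf ne_y) /= => /eqP.
apply: (@leq_trans #|[set z : F | (z ^+ e == 1)%R] :\ 1%R|).
  apply: subset_leq_card; apply/fintype.subsetP => _ /imsetP[x + ->]; rewrite !inE => Px.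
  have nz := nz' _ Px; case/andP: (Px) => _ /eqP exy.
  rewrite -subr_eq0 (_ : (x + y) / (x + y') - 1 = (y - y') / (x + y')); last by field.
  rewrite mulf_eq0 invr_eq0 (negPf nz) orbF subr_eq0 ne_y /=.
  by rewrite expr_div_n exy divff ?expf_neq0.
have := card_unity_roots F e_gt0; rewrite (cardsD1 1) inE expr1n eqxx add1n.
by case: (e).
Qed.

Lemma sum_coset_count_sqr :
  (\sum_(z in V) \sum_x coset_count z x ^ 2 <= t * (d * e) + t * t.-1 * e.-1)%N.
Proof.
have -> : (\sum_(z in V) \sum_x coset_count z x ^ 2 =
  \sum_(y : F) \sum_(y' : F) mu_ind y * mu_ind y' *
   \sum_x (((x + y)%R != 0%R) && ((x + y) ^+ e == (x + y') ^+ e)%R))%N.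
  transitivity (\sum_(z in V) \sum_x \sum_y \sum_y' mu_ind y * mu_ind y' *
     (((x + y) ^+ e == z)%R * ((x + y') ^+ e == z)%R))%N.
    apply: eq_bigr => z _; apply: eq_bigr => x _.
    rewrite -mulnn big_distrlr /=; apply: eq_bigr => y _; apply: eq_bigr => y' _; ring.
  rewrite exchange_big /=.
  under eq_bigr => x _ do rewrite exchange_big /=.
  rewrite exchange_big /=; apply: eq_bigr => y _.
  under eq_bigr => x _ do rewrite exchange_big /=.
  rewrite exchange_big /=; apply: eq_bigr => y' _.
  rewrite big_distrr /=; apply: eq_bigr => x _.
  by rewrite -big_distrr /= sum_coset_indicator.
have -> : (t * (d * e) + t * t.-1 * e.-1 = \sum_(y : F) mu_ind y * (d * e + t.-1 * e.-1))%N.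
  by rewrite -big_distrl /= (sum_mu_ind card_H) mulnDr [(t * (t.-1 * _))%N]mulnA.
apply: leq_sum => y _.
case: (mu_ind_case t y) => hy; rewrite hy; first by rewrite big1 // => y' _; rewrite !mul0n.
rewrite mul1n (bigD1 y) //= hy muln1 mul1n; apply: leq_add.
  apply: eq_leq; rewrite -[RHS](sum_translate_neq0 y); apply: eq_bigr => x _.
  by rewrite eqxx andbT.
have -> : t.-1 = (\sum_(y' | y' != y) mu_ind y')%N.
  by have := sum_mu_ind card_H; rewrite (bigD1 y) //= hy add1n => /(congr1 predn).
rewrite big_distrl /=; apply: leq_sum => y' ne.
rewrite mul1n leq_mul2l equal_powers_count ?orbT // eq_sym //.
Qed.

(** Summation over all cosets of K can only increase the left-hand side, and it
    makes the first moment computable and the second easy to bound. *)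
Lemma variance_coset_count :
  \sum_x ((coset_count 1 x)%:R - t%:R / d%:R) ^+ 2 <= (#|F| * t)%:R :> rat.
Proof.
have d0 : (0 : rat) < d%:R by rewrite ltr0n.
have inV : 1 \in V by rewrite inE expr1n.
apply: (@le_trans _ _ (\sum_(z in V) \sum_x ((coset_count z x)%:R - t%:R / d%:R) ^+ 2)).
  rewrite [X in _ <= X](bigD1 (1 : F)) //= lerDl; apply: sumr_ge0 => z _;
    apply: sumr_ge0 => x _.
  exact: sqr_ge0.
have -> : \sum_(z in V) \sum_x ((coset_count z x)%:R - t%:R / d%:R : rat) ^+ 2 =
   (\sum_(z in V) \sum_x coset_count z x ^ 2)%:R
   - 2 * (t%:R / d%:R) * (\sum_(z in V) \sum_x coset_count z x)%:R
   + (#|V| * #|F|)%:R * (t%:R / d%:R) ^+ 2.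
  rewrite !natr_sum mulr_sumr -sumrB natrM -[#|V|%:R]mulr1.
  rewrite -sum1_card natr_sum mulr_suml mulr_suml mulr_suml -big_split /=.
  apply: eq_bigr => z _;
    rewrite !natr_sum mulr_sumr -sumrB !mul1r -sum1_card natr_sum mulr_suml.
  rewrite -big_split /=; apply: eq_bigr => x _; rewrite natrX; ring.
rewrite sum_coset_count.
have := sum_coset_count_sqr; rewrite -(ler_nat rat).
have := card_unity_roots F d_gt0; rewrite -/V card_F -(ler_nat rat).
have t1 : (0 < t)%N := mu_order_gt0 card_H.
set A2 := (\sum_(z in V) _)%N; move: #|V| => v.
rewrite !natrD !natrM -[(d * e).+1]addn1 natrD natrM -!subn1 !natrB //.
have : (1 : rat) <= t%:R by rewrite ler1n.
have : (1 : rat) <= e%:R by rewrite ler1n.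
have : (1 : rat) <= d%:R by rewrite ler1n.
move: (v%:R : rat) (A2%:R : rat) (t%:R : rat) (d%:R : rat) (e%:R : rat) d0.
move=> V' A T D E D0 D1 E1 T1 leV leA.
pose U := T / D; have def_T : T = U * D by rewrite /U divfK ?lt0r_neq0.
have U0 : 0 <= U by rewrite divr_ge0 //; lra.
rewrite -/U.
have h1 : V' * (D * E + 1) * U ^+ 2 <= D * (D * E + 1) * U ^+ 2.
  by rewrite ler_wpM2r ?sqr_ge0 // ler_wpM2r //; nra.
have h2 : U <= T by rewrite def_T ler_peMr.
have h3 : T * U <= T * T by rewrite ler_wpM2l //; lra.
have e1 : D * (D * E + 1) * U ^+ 2 = E * T ^+ 2 + T * U by rewrite def_T; ring.
have e2 : 2 * U * (T * (D * E)) = 2 * T ^+ 2 * E by rewrite def_T; ring.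
rewrite e2; nra.
Qed.
End Equidistribution.

(** * Sieving out the powers *)

Lemma prod_primes_dvd (s : seq nat) (m : nat) : uniq s -> all prime s ->
  (\prod_(q <- s) q %| m)%N = all (fun q => q %| m)%N s.
Proof.
elim: s => [|q s IH] /=; first by rewrite big_nil dvd1n.
case/andP=> q_s uniq_s /andP[q_pr s_pr]; rewrite big_cons Gauss_dvd ?IH //.
rewrite big_seq; apply: (big_ind (fun k => coprime q k)) => [|x y|r r_s].
- exact: coprimen1.
- by rewrite coprimeMr => -> ->.
- rewrite prime_coprime // dvdn_prime2 ?(allP s_pr r r_s) //.
  by apply: contraNneq q_s => ->.
Qed.

Lemma exists_primitive_root (F : finFieldType) : exists z : F, #|F|.-1.-primitive_root z.
Proof.
have card_gt1 : (1 < #|F|)%N := finNzRing_gt1 F.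
have nz_size : size (enum [pred x : F | x != 0]) = #|F|.-1.
  by rewrite -cardE (cardD1 (0 : F) predT) /=; apply: eq_card => x; rewrite !inE andbT.
have : has #|F|.-1.-primitive_root (enum [pred x : F | x != 0]).
  apply: has_prim_root; rewrite ?enum_uniq ?nz_size //; first by case: #|F| card_gt1 => [|[]].
  apply/allP => x; rewrite mem_enum inE => x0; apply/unity_rootP.
  exact: expf_card_pred.
by case/hasP => z _; exists z.
Qed.

Section Sieve.

Variables (F : finFieldType) (n t : nat).
Local Notation H := [set x : F | x ^+ t == 1].
Hypothesis card_H : #|H| = t.
Hypothesis card_F : #|F| = (n * t).+1.
Hypothesis n_gt0 : (0 < n)%N.
Local Notation mu_ind := (mu_ind t).
Local Notation N := (n * t)%N.
Local Notation omega := (size (primes n)).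

Let q (i : 'I_omega) : nat := nth 1%N (primes n) i.
Let prodJ (J : {set 'I_omega}) : nat := (\prod_(i in J) q i)%N.

Lemma sieving_prime_in (i : 'I_omega) : q i \in primes n.
Proof. exact: mem_nth. Qed.

Lemma sieving_prime (i : 'I_omega) : prime (q i).
Proof. by have := sieving_prime_in i; rewrite mem_primes => /and3P[]. Qed.

Lemma prodJ_dvd (J : {set 'I_omega}) (m : nat) :
  (prodJ J %| m)%N = [forall i in J, (q i %| m)%N].
Proof.
have e : prodJ J = (\prod_(r <- [seq q i | i <- enum J]) r)%N.
  by rewrite big_map big_enum.
rewrite e prod_primes_dvd; first 1 last.
- rewrite map_inj_uniq ?enum_uniq // => i j /eqP.
  by rewrite nth_uniq ?primes_uniq // => /eqP /val_inj.
- by apply/allP => _ /mapP[i _ ->]; apply: sieving_prime.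
apply/allP/forall_inP => [h i iJ | h _ /mapP[i + ->]].
  by apply: h; apply: map_f; rewrite mem_enum.
by rewrite mem_enum; apply: h.
Qed.

Lemma prodJ_dvd_n (J : {set 'I_omega}) : (prodJ J %| n)%N.
Proof.
rewrite prodJ_dvd; apply/forall_inP => i _.
by have := sieving_prime_in i; rewrite mem_primes => /and3P[].
Qed.

Lemma pow_div_eq1 (z : F) (k d : nat) : N.-primitive_root z -> (d %| n)%N ->
  ((z ^+ k) ^+ (N %/ d) == 1) = (d %| k)%N.
Proof.
move=> z_prim d_n; have dN : (d %| N)%N := dvdn_mulr _ d_n.
have e : N = (d * (N %/ d))%N by rewrite [RHS]mulnC divnK.
have N_gt0 : (0 < N)%N := prim_order_gt0 z_prim.
rewrite -exprM -(prim_order_dvd z_prim) {1}e dvdn_pmul2r //.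
by rewrite divn_gt0 ?(dvdn_gt0 N_gt0) // dvdn_leq.
Qed.

(** Inclusion-exclusion for g being no q i-th power for any i.  The exponent of
    g relative to a generator turns the powers into divisibility conditions, which
    are multiplicative over distinct primes. *)
Lemma sieve_indicator (g : F) :
  (g != 0)%:R * \prod_(i < omega) (1 - (g ^+ (N %/ q i) == 1)%:R) =
  \sum_(J : {set 'I_omega}) (-1) ^+ #|J| * (g ^+ (N %/ prodJ J) == 1)%:R :> rat.
Proof.
have [->|g0] := eqVneq g 0.
  rewrite mul0r big1 // => J _; rewrite expr0n gtn_eqF ?(eq_sym (0 : F)) ?oner_eq0 ?mulr0 //.
  rewrite divn_gt0 ?(dvdn_gt0 n_gt0 (prodJ_dvd_n J)) //.
  apply: leq_trans (dvdn_leq n_gt0 (prodJ_dvd_n J)) _.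
  by rewrite leq_pmulr // (mu_order_gt0 card_H).
have [z z_prim] := exists_primitive_root F; rewrite card_F /= in z_prim.
have gN : g ^+ N = 1 by rewrite -(expf_card_pred g0) card_F.
have [k ->] := prim_rootP z_prim gN.
rewrite mul1r.
under eq_bigr => i _ do rewrite addrC.
rewrite bigA_distr; apply: eq_bigr => J _.
rewrite -big_mkcond /= prodrN; congr (_ * _).
under eq_bigr => i iJ.
  rewrite (pow_div_eq1 _ z_prim); last by have := sieving_prime_in i;
    rewrite mem_primes => /and3P[].
over.
rewrite pow_div_eq1 ?prodJ_dvd_n // prodJ_dvd.
case: forall_inP => [h|/forall_inP].
  by rewrite big1 // => i iJ; rewrite h.
rewrite negb_forall_in => /exists_inP[i iJ /negPf ne].
by rewrite (bigD1 i) //= ne mul0r.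
Qed.

(** The sifted sum S has main term W t times the product of the 1 - 1/q i, which is
    at least W t / 2^omega, and 2^omega error terms, each smaller than
    W t / 4^omega by [variance_coset_count] and Cauchy-Schwarz. *)
Lemma exists_sum_avoiding_powers (w : F -> nat) :
  (16 ^ omega * (#|F| * \sum_x w x ^ 2) < (\sum_x w x) ^ 2 * t)%N ->
  exists x y, [/\ (0 < w x)%N, mu_ind y = 1%N, x + y != 0 &
    forall r, r \in primes n -> (x + y) ^+ (N %/ r) != 1].
Proof.
move=> lt_err; set W := (\sum_x w x)%N in lt_err.
pose a (J : {set 'I_omega}) (x : F) := coset_count t (N %/ prodJ J) 1 x.
pose err (J : {set 'I_omega}) : rat := \sum_x (w x)%:R * ((a J x)%:R - t%:R / (prodJ J)%:R).
have t_pos := mu_order_gt0 card_H.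
have W_gt0 : (0 < W)%N by case: W lt_err => //; rewrite exp0n.
have err_small J : `|err J| * 4 ^+ omega < (W * t)%:R.
  have d_gt0 := dvdn_gt0 n_gt0 (prodJ_dvd_n J).
  have eN : N = (prodJ J * (N %/ prodJ J))%N
    by rewrite [RHS]mulnC divnK // dvdn_mulr // prodJ_dvd_n.
  have e_gt0 : (0 < N %/ prodJ J)%N.
    rewrite divn_gt0 //; apply: leq_trans (dvdn_leq n_gt0 (prodJ_dvd_n J)) _.
    by rewrite leq_pmulr.
  have card_F' : #|F| = (prodJ J * (N %/ prodJ J)).+1 by rewrite -eN.
  have var := variance_coset_count card_H card_F' d_gt0 e_gt0.
  have cs := cauchy_schwarz_sum (fun x => (w x)%:R : rat)
               (fun x => (a J x)%:R - t%:R / (prodJ J)%:R).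
  rewrite -(@ltr_pXn2r _ 2) ?nnegrE ?mulr_ge0 ?exprn_ge0 // exprMn real_normK ?num_real //.
  have le1 : err J ^+ 2 <= (\sum_x w x ^ 2)%:R * (#|F| * t)%:R.
    apply: le_trans cs _; rewrite natr_sum; under [X in _ <= X * _]eq_bigr do rewrite natrX.
    by apply: ler_wpM2l var; apply: sumr_ge0 => x _; apply: sqr_ge0.
  have e16 : ((4 : rat) ^+ omega) ^+ 2 = (16 ^ omega)%:R by rewrite exprAC natrX.
  rewrite e16; apply: le_lt_trans (ler_wpM2r _ le1) _ => //.
  rewrite -!natrM -natrX ltr_nat -mulnA mulnC -mulnA.
  have : (16 ^ omega * (#|F| * \sum_x w x ^ 2) * t < W ^ 2 * t * t)%N by rewrite ltn_pmul2r.
  by congr (_ < _)%N; ring.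
pose S : rat := \sum_x \sum_y (w x)%:R * (mu_ind y)%:R *
   ((x + y != 0)%:R * \prod_(i < omega) (1 - ((x + y) ^+ (N %/ q i) == 1)%:R)).
have S_expand : S = \sum_(J : {set 'I_omega}) (-1) ^+ #|J| *
  ((W * t)%:R / (prodJ J)%:R + err J).
  rewrite /S; under eq_bigr => x _ do under eq_bigr => y _ do rewrite sieve_indicator mulr_sumr.
  under eq_bigr => x _ do rewrite exchange_big /=.
  rewrite exchange_big /=; apply: eq_bigr => J _.
  rewrite /err; under [X in _ = _ * (_ + X)]eq_bigr => x _ do rewrite mulrBr.
  rewrite sumrB -mulr_suml natrM -mulrA /W natr_sum addrC subrK mulr_sumr.
  apply: eq_bigr => x _; rewrite /a /coset_count natr_sum !mulr_sumr.
  by apply: eq_bigr => y _; rewrite natrM; ring.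
have S_gt0 : 0 < S.
  have prod_expand : \sum_(J : {set 'I_omega}) (-1) ^+ #|J| * ((W * t)%:R / (prodJ J)%:R) =
      (W * t)%:R * \prod_(i < omega) (1 - (q i)%:R^-1) :> rat.
    under [in RHS]eq_bigr => i _ do rewrite addrC.
    rewrite bigA_distr mulr_sumr; apply: eq_bigr => J _.
    by rewrite -big_mkcond /= prodrN /prodJ natr_prod prodfV mulrCA.
  have half_le (i : 'I_omega) : 2^-1 <= 1 - (q i)%:R^-1 :> rat.
    have q2 : (2 : rat) <= (q i)%:R by rewrite (ler_nat _ 2) prime_gt1 ?sieving_prime.
    have : ((q i)%:R : rat)^-1 <= 2^-1 by rewrite lef_pV2 ?posrE //; lra.
    lra.
  have prod_ge : (2^-1) ^+ omega <= \prod_(i < omega) (1 - (q i)%:R^-1) :> rat.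
    rewrite -[X in _ ^+ X]card_ord -prodr_const; apply: ler_prod => i _.
    by rewrite half_le andbT.
  have card_sets : #|{: {set 'I_omega}}| = (2 ^ omega)%N.
    by rewrite -cardsT -finset.powersetT card_powerset cardsT card_ord.
  have sum_err : \sum_(J : {set 'I_omega}) `|err J| * 4 ^+ omega < (W * t)%:R * 2 ^+ omega.
    have -> : (W * t)%:R * 2 ^+ omega = \sum_(J : {set 'I_omega}) (W * t)%:R :> rat.
      by rewrite sumr_const card_sets -[RHS]mulr_natr natrX.
    by apply: ltr_sum => //; apply/hasP; exists finset.set0; rewrite ?mem_index_enum.
  rewrite S_expand; under eq_bigr => J _ do rewrite mulrDr.
  rewrite big_split /= prod_expand.
  set Y := \sum_(J : {set _}) _ * err J.
  have leY : `|Y| <= \sum_(J : {set 'I_omega}) `|err J|.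
    apply: le_trans (ler_norm_sum _ _ _) _; apply: ler_sum => J _.
    by rewrite normrM normrX normrN1 expr1n mul1r.
  have pow2 : (0 : rat) < 2 ^+ omega by rewrite exprn_gt0.
  have pow4 : (4 : rat) ^+ omega = 2 ^+ omega * 2 ^+ omega by rewrite -exprMn -natrM.
  move: sum_err; rewrite -mulr_suml pow4 mulrA ltr_pM2r // => sum_err.
  have WT0 : (0 : rat) <= (W * t)%:R by [].
  have main_ge := ler_wpM2l WT0 prod_ge.
  have := ler_wpM2r (ltW pow2) main_ge; rewrite -mulrA -exprMn mulVf // expr1n mulr1 => main2.
  rewrite -(pmulr_lgt0 _ pow2) mulrDl.
  have := ler_wpM2r (ltW pow2) leY; have := ler_norm (- Y); rewrite normrN => le_Y.
  have := ler_wpM2r (ltW pow2) le_Y; rewrite mulNr; lra.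
have [x0 /existsP[y0 /and4P[w0 h0 xy0 pr0]]] : exists x, [exists y,
  [&& (0 < w x)%N, mu_ind y == 1%N, x + y != 0 &
    [forall i : 'I_omega, (x + y) ^+ (N %/ q i) != 1]]].
  apply/existsP; apply: contraTT S_gt0; rewrite -leNgt => /existsPn no.
  rewrite /S big1 // => x _; rewrite big1 // => y _.
  have /existsPn/(_ y) := no x; rewrite !negb_and -!leqNgt.
  case/or4P.
  - by rewrite leqn0 => /eqP ->; rewrite !mul0r.
  - by case: (mu_ind_case t y) => -> // _; rewrite mulr0 mul0r.
  - by rewrite negbK => /eqP ->; rewrite eqxx mul0r mulr0.
  - rewrite negb_forall => /existsP[i]; rewrite negbK => pi.
    by rewrite (bigD1 i) //= pi subrr mul0r !mulr0.
exists x0, y0; split => //; first exact/eqP.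
move=> r r_in; have ltr : (index r (primes n) < omega)%N by rewrite index_mem.
by have /forallP/(_ (Ordinal ltr)) := pr0; rewrite /q /= nth_index.
Qed.

End Sieve.

(** * Three-term sums in the coset of a generator *)

(** With tau = t^3 / (40 p L) the sieve condition holds by construction, and
    t^3 < 80 p L tau turns every other requirement into one on t and p.  The
    exponent 13/33 enters through t^198 >= p^78, which beats the p^77 on the other
    side of tau^7 > k t^3 l^3 by one factor p; the losses L and l are absorbed by
    that factor. *)
Lemma parameter_choice (p t L l k : nat) :
  (0 < L)%N -> (0 < l)%N -> (0 < k)%N ->
  (p ^ 13 <= t ^ 33)%N -> ((k * l ^ 3 * (80 * L) ^ 7) ^ 11 <= p)%N ->
  exists tau, [/\ (40 * p * L * tau <= t ^ 3)%N, (20 <= t)%N, (5 <= tau)%N,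
    (tau <= t -> 16 * t ^ 5 <= p ^ 3)%N &
    (24 * t ^ 6 <= p ^ 3 * tau ^ 2)%N /\ (k * t ^ 3 * l ^ 3 < tau ^ 7)%N].
Proof.
move=> L0 l0 k0 pt; set M := (k * l ^ 3 * (80 * L) ^ 7)%N => Mp.
have leDM : ((80 * L) ^ 7 <= M)%N by rewrite leq_pmull // muln_gt0 k0 expn_gt0 l0.
have leM : (M <= p)%N.
  apply: leq_trans Mp; case: (M) => // m; rewrite -{1}[m.+1]expn1.
  by apply: leq_pexp2l.
set D := (80 * L)%N in M Mp leDM leM.
have D80 : (80 <= D)%N by rewrite /D leq_pmulr.
have D_gt0 : (0 < D)%N := leq_trans (isT : 0 < 80)%N D80.
have le_DX i : (i <= 7)%N -> (D ^ i <= D ^ 7)%N by move=> le_i; rewrite leq_pexp2l.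
have p_gt0 : (0 < p)%N by apply: leq_trans leM; apply: leq_trans leDM; rewrite expn_gt0 D_gt0.
have p80 : (80 <= p)%N.
  by apply: leq_trans leM; apply: leq_trans leDM; apply: leq_trans D80 (le_DX 1 isT).
have large : (200 * p * L <= t ^ 3)%N.
  rewrite -(@leq_exp2r _ _ 11) // -expnM; apply: leq_trans pt.
  have -> : ((200 * p * L) ^ 11 = p ^ 11 * (200 * L) ^ 11)%N by rewrite -expnMn;
    congr (_ ^ _)%N; ring.
  apply: (@leq_trans (p ^ 11 * p ^ 1)); last by rewrite -expnD leq_pexp2l.
  rewrite leq_mul2l; apply/orP; right; apply: leq_trans Mp; rewrite leq_exp2r //.
  apply: leq_trans leDM; apply: leq_trans (le_DX 2 isT); rewrite /D; nia.
have t20 : (20 <= t)%N.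
  rewrite leqNgt; apply/negP => t_lt; have : (t ^ 3 <= 19 ^ 3)%N by rewrite leq_exp2r.
  have : (200 * 80 * 1 <= t ^ 3)%N by apply: leq_trans large; rewrite leq_mul // leq_mul.
  by move=> h1 /(leq_trans h1).
pose tau := (t ^ 3 %/ (40 * p * L))%N; exists tau.
have d_gt0 : (0 < 40 * p * L)%N by rewrite !muln_gt0 p_gt0 L0.
have tau5 : (5 <= tau)%N.
  by rewrite leq_divRL //; apply: leq_trans large; apply/eq_leq; ring.
have lt_t : (t ^ 3 < p * D * tau)%N.
  have := ltn_ceil (t ^ 3) d_gt0; rewrite -/tau => /leq_trans; apply.
  have -> : (p * D * tau = (2 * tau) * (40 * p * L))%N by rewrite /D; ring.
  by rewrite leq_mul2r; apply/orP; right; lia.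
split => //; first by rewrite mulnC leq_divM.
- move=> le_tau.
  have lt_t2 : (t ^ 2 <= p * D)%N.
    have t_gt0 : (0 < t)%N := leq_trans (isT : 0 < 20)%N t20.
    rewrite -(leq_pmul2r t_gt0) -expnSr; apply: leq_trans (ltnW lt_t) _.
    by rewrite leq_mul2l le_tau orbT.
  rewrite -(@leq_exp2r _ _ 2) // expnMn -!expnM.
  have : ((t ^ 2) ^ 5 <= (p * D) ^ 5)%N by rewrite leq_exp2r.
  rewrite -expnM expnMn => le5; apply: leq_trans (leq_mul (leqnn _) le5) _.
  rewrite mulnCA; apply: (@leq_trans (p ^ 5 * p ^ 1)); last by rewrite -expnD.
  rewrite leq_mul2l; apply/orP; right; apply: leq_trans leM; apply: leq_trans leDM.
  apply: (@leq_trans (D ^ 2 * D ^ 5)); last by rewrite -expnD.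
  by rewrite leq_mul2r leq_exp2r // (leq_trans _ D80) ?orbT.
split.
- have : ((t ^ 3) ^ 2 <= (p * D * tau) ^ 2)%N by rewrite leq_exp2r // ltnW.
  rewrite -expnM => le2; apply: leq_trans (leq_mul (leqnn _) le2) _.
  have -> : (24 * (p * D * tau) ^ 2 = (24 * D ^ 2) * (p ^ 2 * tau ^ 2))%N by ring.
  have -> : (p ^ 3 * tau ^ 2 = p * (p ^ 2 * tau ^ 2))%N by ring.
  rewrite leq_mul2r; apply/orP; right; apply: leq_trans leM; apply: leq_trans leDM.
  apply: leq_trans (le_DX 3 isT); rewrite expnS leq_mul2r.
  by rewrite (leq_trans _ D80) ?orbT.
have big : (k * l ^ 3 * D ^ 7 * p ^ 7 <= t ^ 18)%N.
  rewrite -(@leq_exp2r _ _ 11) // -expnM expnMn -/M.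
  apply: (@leq_trans (p ^ 1 * (p ^ 7) ^ 11)); first by rewrite leq_mul2r Mp orbT.
  rewrite -expnM -expnD; have : ((p ^ 13) ^ 6 <= (t ^ 33) ^ 6)%N by rewrite leq_exp2r.
  by rewrite -!expnM.
have pD_gt0 : (0 < (p * D) ^ 7)%N by rewrite expn_gt0 muln_gt0 p_gt0 D_gt0.
rewrite -(ltn_pmul2r pD_gt0) -[(tau ^ 7 * _)%N]mulnC -expnMn.
have : ((t ^ 3) ^ 7 < (p * D * tau) ^ 7)%N by rewrite ltn_exp2r.
apply: leq_ltn_trans; rewrite -expnM -[(3 * 7)%N]/(18 + 3)%N expnD.
by apply: leq_trans (leq_mul big (leqnn (t ^ 3))); apply/eq_leq; rewrite expnMn; ring.
Qed.

Section ThreeTermSums.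

Variables (F : finFieldType) (p n t : nat).
Hypothesis charFp : p \in [pchar F].
Hypothesis card_F : #|F| = p.
Local Notation H := [set x : F | x ^+ t == 1].
Hypothesis card_H : #|H| = t.
Hypothesis p_eq : p = (n * t).+1.
Hypothesis n_gt0 : (0 < n)%N.
Local Notation mu_ind := (mu_ind t).
Local Notation sum_reps := (@sum_reps F t).
Local Notation L := (16 ^ size (primes n))%N.

(** The weight counts representations as a sum of two elements of H, but only for
    nonzero unpopular sums; they carry at least t^2 / 20 of the t^2 pairs, and
    sum w^2 <= tau sum w. *)
Lemma three_term_sum_of_unpopular (tau : nat) :
  (20 <= t)%N -> (0 < tau)%N -> (40 * p * L * tau <= t ^ 3)%N ->
  (10 * \sum_(x in superlevel sum_reps tau) sum_reps x < 9 * t ^ 2)%N ->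
  exists h1 h2 h3 : F, [/\ mu_ind h1 = 1%N, mu_ind h2 = 1%N, mu_ind h3 = 1%N,
    h1 + h2 + h3 != 0 &
    forall r, r \in primes n -> (h1 + h2 + h3) ^+ (n * t %/ r) != 1].
Proof.
move=> t20 tau_gt0 le_tau few.
pose w (x : F) : nat := if (x != 0) && (sum_reps x < tau)%N then sum_reps x else 0%N.
have card_F' : #|F| = (n * t).+1 by rewrite card_F.
pose W := (\sum_x w x)%N.
have leW : (t ^ 2 <= 20 * W)%N.
  have : (t ^ 2 <= t + \sum_(x in superlevel sum_reps tau) sum_reps x + W)%N.
    rewrite -(sum_sum_reps_all card_H) (bigD1
      (0%R : F)) //= -addnA leq_add ?(sum_reps_le card_H) //.
    rewrite /W [X in (_ <= X + _)%N]big_mkcond [X in (X <= _)%N]big_mkcond -big_split /=.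
    apply: leq_sum => x _; rewrite inE /w; case: (x != 0) => //=.
    by rewrite [(tau <= sum_reps x)%N]leqNgt; case: (sum_reps x < tau)%N; rewrite /= ?addn0.
  by move: few; move: (\sum_(x in _) _)%N W => s W'; nia.
have leV : (\sum_x w x ^ 2 <= tau * W)%N.
  rewrite /W big_distrr; apply: leq_sum => x _; rewrite /w.
  by case: ifP => //= /andP[_ /ltnW le]; rewrite -mulnn leq_mul2r le orbT.
have p_gt0 : (0 < p)%N by rewrite p_eq.
have ltV : (L * (#|F| * \sum_x w x ^ 2) < W ^ 2 * t)%N.
  apply: leq_ltn_trans (leq_mul (leqnn _) (leq_mul (leqnn _) leV)) _.
  rewrite card_F.
  have L_gt0 : (0 < L)%N by rewrite expn_gt0.
  have W_gt0 : (0 < W)%N by rewrite lt0n; apply: contraTneq leW => ->;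
    rewrite muln0 -ltnNge expn_gt0 (mu_order_gt0 card_H).
  have -> : (L * (p * (tau * W)) = p * L * tau * W)%N by ring.
  have -> : (W ^ 2 * t = W * t * W)%N by ring.
  rewrite ltn_pmul2r //.
  have : (0 < p * L * tau)%N by rewrite !muln_gt0 p_gt0 L_gt0.
  move: le_tau; rewrite -!mulnA; move: (p * _)%N => X le1 X0.
  have le2 := leq_mul leW (leqnn t); nia.
have [x [y [wx hy xy0 prim]]] := exists_sum_avoiding_powers card_H card_F' n_gt0 ltV.
have : sum_reps x != 0%N.
  by move: wx; rewrite /w; case: ifP => // _; rewrite lt0n.
rewrite /sum_reps sum_nat_eq0 negb_forall => /existsP[h /=];
  rewrite muln_eq0 negb_or => /andP[hh hxh].
have one (z : F) : mu_ind z != 0%N -> mu_ind z = 1%N by case: (mu_ind_case t z) => ->.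
exists h, (x - h), y; rewrite [h + _]addrC subrK; split => //; exact: one.
Qed.

Theorem three_term_sum :
  (p ^ 13 <= t ^ 33)%N ->
  ((2 ^ 79 * (trunc_log 2 t).+1 ^ 3 * (80 * L) ^ 7) ^ 11 <= p)%N ->
  exists h1 h2 h3 : F, [/\ mu_ind h1 = 1%N, mu_ind h2 = 1%N, mu_ind h3 = 1%N,
    h1 + h2 + h3 != 0 &
    forall r, r \in primes n -> (h1 + h2 + h3) ^+ (n * t %/ r) != 1].
Proof.
move=> pt Mp.
have L_gt0 : (0 < L)%N by rewrite expn_gt0.
have k_gt0 (k : nat) : (0 < 2 ^ k)%N by rewrite expn_gt0.
have [tau [le_tau t20 tau5 t5p [t6p tau7]]] :=
  parameter_choice L_gt0 (ltn0Sn _) (k_gt0 79%N) pt Mp.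
apply: (three_term_sum_of_unpopular t20 _ le_tau); first exact: leq_trans tau5.
apply: (few_popular_sums charFp card_H) t6p tau7 => //; exact: leq_trans t20.
Qed.

End ThreeTermSums.

(** * From cosets to three binary digits *)

Lemma coprime_of_primes (a b : nat) : (0 < b)%N ->
  (forall r, prime r -> (r %| a)%N -> (r %| b)%N -> False) -> coprime a b.
Proof.
move=> b_gt0 no; rewrite /coprime eqn_leq gcdn_gt0 b_gt0 orbT andbT leqNgt.
apply/negP => /pdiv_prime pr.
by apply: (no _ pr); apply: dvdn_trans (pdiv_dvd _) _; [apply: dvdn_gcdl|apply: dvdn_gcdr].
Qed.

(** For n dividing N this is the surjectivity of the units modulo N onto the
    units modulo n.  The multiplier j is the product of the primes dividing N but
    not k: a prime dividing N then divides exactly one of k and n j. *)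
Lemma coprime_lift (k n N : nat) : (0 < N)%N -> coprime k n ->
  exists j, coprime (k + n * j) N.
Proof.
move=> N_gt0 cop; exists (\prod_(q <- primes N | ~~ (q %| k)) q)%N.
set j := (\prod_(q <- _ | _) q)%N.
apply: coprime_of_primes => // r r_pr r_sum r_N.
have r_in : r \in primes N by rewrite mem_primes r_pr N_gt0.
have [r_k|r_k] := boolP (r %| k)%N.
  have : (r %| n * j)%N by rewrite -(dvdn_addr _ r_k).
  rewrite Euclid_dvdM // => /orP[r_n|].
    have : (r %| gcdn k n)%N by rewrite dvdn_gcd r_k.
    by rewrite (eqP cop) dvdn1 => /eqP r1; rewrite r1 in r_pr.
  have no : (r %| j)%N = false.
    apply/negbTE; rewrite /j big_seq_cond.
    apply: (big_ind (fun m => ~~ (r %| m)%N)) => [|x y hx hy|q].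
    - by rewrite dvdn1; apply: contraTneq r_pr => ->.
    - by rewrite Euclid_dvdM // negb_or hx hy.
    - rewrite mem_primes => /andP[/andP[q_pr _] q_k].
      by rewrite dvdn_prime2 //; apply: contraNneq q_k => <-.
  by rewrite no.
have : (r %| j)%N.
  by rewrite /j big_mkcond (bigD1_seq r) ?primes_uniq //= r_k dvdn_mulr.
by move=> r_j; move: r_sum; rewrite dvdn_addl ?(negPf r_k) // dvdn_mull.
Qed.

(** An element generating the quotient by H lifts to a generator. *)
Lemma primitive_in_coset (F : finFieldType) (n t : nat) (g : F) :
  #|[set x : F | x ^+ t == 1]| = t -> #|F| = (n * t).+1 -> (0 < n)%N ->
  g != 0 -> (forall r, r \in primes n -> g ^+ (n * t %/ r) != 1) ->
  exists2 h : F, h ^+ t = 1 & (n * t).-primitive_root (g * h).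
Proof.
move=> card_H card_F n_gt0 g0 no_root.
have [z z_prim] := exists_primitive_root F; rewrite card_F /= in z_prim.
have gN : g ^+ (n * t) = 1 by rewrite -(expf_card_pred g0) card_F.
have [k def_g] := prim_rootP z_prim gN.
have cop : coprime k n.
  apply: coprime_of_primes => // r r_pr r_k r_n.
  have /no_root : r \in primes n by rewrite mem_primes r_pr n_gt0.
  by rewrite def_g (pow_div_eq1 _ z_prim) // r_k.
have [j cop_j] := coprime_lift (prim_order_gt0 z_prim) cop.
exists (z ^+ (n * j)).
  by rewrite -exprM mulnAC exprM (prim_expr_order z_prim) expr1n.
by rewrite def_g -exprD prim_root_exp_coprime.
Qed.

Lemma card_unity_roots_prim (F : finFieldType) (t : nat) (z : F) :
  t.-primitive_root z -> #|[set x : F | x ^+ t == 1]| = t.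
Proof.
move=> z_prim; have t_pos := prim_order_gt0 z_prim.
apply/eqP; rewrite eqn_leq card_unity_roots //=.
have inj : injective (fun i : 'I_t => z ^+ i).
  move=> i j /eqP; rewrite (eq_prim_root_expr z_prim) !modn_small // => /eqP; exact: val_inj.
rewrite -[X in (X <= _)%N]card_ord -(card_imset _ inj); apply: subset_leq_card.
apply/fintype.subsetP => _ /imsetP[i _ ->]; rewrite inE exprAC.
by rewrite (prim_expr_order z_prim) expr1n.
Qed.

(** Positions beyond the leading digit contribute nothing. *)
Lemma digits_wide (N n : nat) : (n < 2 ^ N)%N ->
  nonzero_binary_digits n = (\sum_(i < N) (n %/ 2 ^ i) %% 2)%N.
Proof.
have stable k m : (m < 2 ^ k)%N -> forall j, (\sum_(i < k + j) (m %/ 2 ^ i) %% 2 =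
    \sum_(i < k) (m %/ 2 ^ i) %% 2)%N.
  move=> lt_m; elim=> [|j IH]; first by rewrite addn0.
  rewrite addnS big_ord_recr /= IH divn_small ?addn0 //.
  by apply: leq_trans lt_m _; rewrite leq_pexp2l ?leq_addr.
move=> lt_n; rewrite /nonzero_binary_digits.
rewrite -(stable _ _ (ltn_expl n (isT : 1 < 2)%N) N) addnC.
exact: stable.
Qed.

Lemma digits_double (n : nat) (b : bool) :
  nonzero_binary_digits (b + n.*2)%N = (b + nonzero_binary_digits n)%N.
Proof.
have lt_n := ltn_expl n (isT : 1 < 2)%N.
rewrite (digits_wide lt_n) (@digits_wide n.+1); last by rewrite expnS; case: b; lia.
rewrite big_ord_recl expn0 divn1; congr (_ + _)%N.
  by rewrite -muln2 addnC modnMDl modn_small //; case: b.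
apply: eq_bigr => i _; rewrite lift0 expnS divnMA; congr ((_ %/ _) %% _)%N.
by rewrite -muln2 addnC divnMDl // divn_small ?addn0 //; case: b.
Qed.

Lemma digits_mul_pow2 (k n : nat) :
  nonzero_binary_digits (2 ^ k * n) = nonzero_binary_digits n.
Proof.
elim: k => [|k IH]; first by rewrite mul1n.
by rewrite expnS -mulnA mul2n (digits_double _ false) IH.
Qed.

Lemma digits_succ (k n : nat) : (0 < k)%N ->
  nonzero_binary_digits (1 + 2 ^ k * n) = (nonzero_binary_digits n).+1.
Proof.
case: k => // k _; rewrite expnS -mulnA mul2n (digits_double _ true).
by rewrite digits_mul_pow2.
Qed.

Lemma digits_three_powers (a b c : nat) : (a < b)%N -> (b < c)%N ->
  nonzero_binary_digits (2 ^ a + 2 ^ b + 2 ^ c) = 3%N.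
Proof.
move=> ab bc.
have -> : (2 ^ a + 2 ^ b + 2 ^ c =
  2 ^ a * (1 + 2 ^ (b - a) * (1 + 2 ^ (c - b) * (1 + 2 ^ 1 * 0))))%N.
  have -> : (2 ^ c = 2 ^ a * (2 ^ (b - a) * 2 ^ (c - b)))%N.
    by rewrite -!expnD; congr (_ ^ _)%N; lia.
  have -> : (2 ^ b = 2 ^ a * 2 ^ (b - a))%N by rewrite -expnD; congr (_ ^ _)%N; lia.
  ring.
rewrite digits_mul_pow2 !digits_succ ?subn_gt0 //.
by rewrite /nonzero_binary_digits big_ord0.
Qed.

Lemma primitive_root_modP (p g : nat) : prime p -> (0 < g)%N ->
  p.-1.-primitive_root (g%:R : 'F_p) -> primitive_root_mod p g.
Proof.
move=> p_pr g_gt0 g_prim; rewrite /primitive_root_mod g_gt0 /=.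
have p_gt1 := prime_gt1 p_pr.
have g_unit : (g%:R : 'F_p) \is a GRing.unit.
  rewrite unitfE; apply/negP => /eqP g0; have := prim_expr_order g_prim.
  by rewrite g0 expr0n (gtn_eqF (prim_order_gt0 g_prim)) => /eqP; rewrite eq_sym oner_eq0.
apply/existsP; exists (FinRing.unit 'F_p g_unit); rewrite eqxx /= /generator.
rewrite eq_sym eqEcard finset.subsetT /= card_finField_unit card_Fp //.
apply: dvdn_leq; first exact: order_gt0.
rewrite (prim_order_dvd g_prim).
have /(congr1 (@FinRing.uval _)) := expg_order (FinRing.unit 'F_p g_unit).
by rewrite FinRing.val_unitX /= => ->.
Qed.

(** * Counting the exceptional primes *)

Lemma prod_primes_le (n : nat) : (0 < n)%N -> (\prod_(q <- primes n) q <= n)%N.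
Proof.
move=> n_gt0; apply: dvdn_leq => //; rewrite prod_primes_dvd ?primes_uniq //.
  by apply/allP => q; rewrite mem_primes => /and3P[].
by apply/allP => q; rewrite mem_primes => /and3P[].
Qed.

(** Prime divisors q >= 2^K pay for their factor 2^K themselves; the fewer than
    2^K smaller ones cost a constant. *)
Lemma prime_divisors_pow_bound (K : nat) : exists2 C, (0 < C)%N &
  forall n, (0 < n)%N -> (2 ^ (K * size (primes n)) <= C * n)%N.
Proof.
exists ((2 ^ K) ^ (2 ^ K))%N; first by rewrite !expn_gt0.
move=> n n_gt0; have K_gt0 : (0 < 2 ^ K)%N by rewrite expn_gt0.
move: (2 ^ K)%N (expnM 2 K) K_gt0 => b -> b_gt0.
apply: leq_trans (leq_mul (leqnn _) (prod_primes_le n_gt0)).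
apply: (@leq_trans (\prod_(q <- primes n) ((if (q < b)%N then b else 1) * q))%N).
  have -> : (b ^ size (primes n) = \prod_(q <- primes n) b)%N.
    by rewrite big_const_seq count_predT iter_muln_1.
  rewrite big_seq [X in (_ <= X)%N]big_seq; apply: leq_prod => q.
  rewrite mem_primes => /andP[/prime_gt0 q_gt0 _].
  by case: ltnP => h; rewrite ?mul1n ?leq_pmulr.
rewrite big_split leq_mul2r /=; apply/orP; right.
rewrite -big_mkcond /= -big_filter big_const_seq count_predT iter_muln_1.
rewrite leq_pexp2l //.
rewrite -[X in (_ <= X)%N](size_iota 0); apply: uniq_leq_size.
  by rewrite filter_uniq // primes_uniq.
by move=> q; rewrite mem_filter mem_iota => /andP[].
Qed.

(** If l is the integral binary logarithm of p, then l + 1 <= K 2^(l / K), where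
    l / K is rounded down. *)
Lemma log_pow_bound (K : nat) : (0 < K)%N -> exists2 C, (0 < C)%N &
  forall p, (0 < p)%N -> ((trunc_log 2 p).+1 ^ K <= C * p)%N.
Proof.
move=> K_gt0; exists (K ^ K)%N; first by rewrite expn_gt0 K_gt0.
move=> p p_gt0; set l := trunc_log 2 p.
have le_l : (l.+1 <= K * 2 ^ (l %/ K))%N.
  apply: leq_trans (ltn_ceil l K_gt0) _; rewrite mulnC leq_mul2l.
  by rewrite ltn_expl ?orbT.
have : (l.+1 ^ K <= (K * 2 ^ (l %/ K)) ^ K)%N by rewrite leq_exp2r.
move=> /leq_trans; apply; rewrite expnMn leq_mul2l -expnM; apply/orP; right.
have /andP[le_p _] := trunc_log_bounds (isT : 1 < 2)%N p_gt0.
by apply: leq_trans le_p; rewrite leq_pexp2l // leq_divM.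
Qed.

(** The fourth powers of the two losses are each O(p), so their product is
    O(p^(1/2)). *)
Lemma subpolynomial_losses (c : nat) : exists p0, forall p n t : nat,
  (p0 <= p)%N -> (0 < n <= p)%N -> (0 < t <= p)%N ->
  (c * (trunc_log 2 t).+1 ^ 33 * 16 ^ (77 * size (primes n)) <= p)%N.
Proof.
have [C1 C1_gt0 log_le] := @log_pow_bound 132 isT.
have [C2 C2_gt0 omega_le] := prime_divisors_pow_bound 1232.
exists (c ^ 4 * C1 * C2)%N => p n t le_p /andP[n_gt0 le_n] /andP[t_gt0 le_t].
have p_gt0 : (0 < p)%N := leq_trans n_gt0 le_n.
have pow4 (x y : nat) : ((c * x * y) ^ 4 = c ^ 4 * x ^ 4 * y ^ 4)%N by ring.
rewrite -(@leq_exp2r _ _ 4) // pow4 -!expnM.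
have -> : (16 ^ (77 * size (primes n) * 4) = 2 ^ (1232 * size (primes n)))%N.
  rewrite -[16%N]/(2 ^ 4)%N -expnM; congr (_ ^ _)%N; ring.
have le1 : ((trunc_log 2 t).+1 ^ (33 * 4) <= C1 * p)%N.
  by apply: leq_trans (log_le t t_gt0) _; rewrite leq_mul2l le_t orbT.
have le2 : (2 ^ (1232 * size (primes n)) <= C2 * p)%N.
  by apply: leq_trans (omega_le n n_gt0) _; rewrite leq_mul2l le_n orbT.
apply: leq_trans (leq_mul (leq_mul (leqnn _) le1) le2) _.
have -> : (c ^ 4 * (C1 * p) * (C2 * p) = c ^ 4 * C1 * C2 * p ^ 2)%N by ring.
apply: leq_trans (leq_mul le_p (leqnn _)) _.
by rewrite -expnS leq_pexp2l.
Qed.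

(** The exponents of the three powers of 2 are shifted by 0, t and 2 t, which does
    not change their residues and makes them distinct. *)
Theorem exceptional_prime_small_order : exists p0, forall p : nat, (p0 <= p)%N ->
  prime p -> (3 < least_digits p)%N ->
  exists t, [/\ (0 < t)%N, (t ^ 33 < p ^ 13)%N & (p %| 2 ^ t - 1)%N].
Proof.
have [p0 losses] := subpolynomial_losses ((2 ^ 79 * 80 ^ 7) ^ 11).
exists (p0 + 3)%N => p le_p p_pr exc.
have p_gt2 : (2 < p)%N by apply: leq_trans le_p; rewrite leq_addl.
pose F : finFieldType := 'F_p.
have card_F : #|F| = p := card_Fp p_pr.
have charFp : p \in [pchar F] := pchar_Fp p_pr.
have two_neq0 : (2%:R : F) != 0.
  by rewrite -(dvdn_pcharf charFp) gtnNdvd.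
have two_pow : (2%:R : F) ^+ p.-1 = 1.
  by have := expf_card_pred two_neq0; rewrite card_F.
have p1_gt0 : (0 < p.-1)%N by rewrite -ltnS prednK ?prime_gt0 // prime_gt1.
have [t t_prim t_dvd] := prim_order_exists p1_gt0 two_pow.
have t_gt0' := prim_order_gt0 t_prim.
exists t; split => //; last first.
  rewrite (dvdn_pcharf charFp) natrB ?expn_gt0 // natrX.
  by rewrite (prim_expr_order t_prim) subrr.
rewrite ltnNge; apply/negP => pt; move: exc; rewrite ltnNge => /negP; apply.
rewrite /least_digits; case: ex_minnP => m _; apply; apply/asboolP.
pose n := (p.-1 %/ t)%N.
have p_eq : p = (n * t).+1 by rewrite /n divnK // prednK // prime_gt0.
have n_gt0 : (0 < n)%N by rewrite divn_gt0 // dvdn_leq.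
have le_np : (n <= p)%N by rewrite p_eq leqW // leq_pmulr.
have le_tp : (t <= p)%N by rewrite p_eq leqW // leq_pmull.
have card_H := card_unity_roots_prim t_prim.
have loss : ((2 ^ 79 * (trunc_log 2 t).+1 ^ 3 * (80 * 16 ^ size (primes n)) ^ 7) ^ 11 <= p)%N.
  have := losses p n t (leq_trans (leq_addr _ _) le_p) _ _.
  rewrite n_gt0 le_np t_gt0' le_tp => /(_ isT isT).
  have gen (a b x y : nat) : ((a * x ^ 3 * (b * y) ^ 7) ^ 11 =
    (a * b ^ 7) ^ 11 * x ^ 33 * y ^ 77)%N.
    have mon (u v w : nat) : ((u * v * w) ^ 11 = u ^ 11 * v ^ 11 * w ^ 11)%N by ring.
    rewrite (expnMn b) (_ : a * x ^ 3 * (b ^ 7 * y ^ 7) = a * b ^ 7 * x ^ 3 * y ^ 7)%N;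
      last by ring.
    by rewrite mon -!expnM.
  by rewrite gen -expnM [(size _ * 77)%N]mulnC.
have [h1 [h2 [h3 [H1 H2 H3 g0 no_root]]]] :=
  three_term_sum charFp card_F card_H p_eq n_gt0 pt loss.
have card_F' : #|F| = (n * t).+1 by rewrite card_F.
have [h h_t g_prim] := primitive_in_coset card_H card_F' n_gt0 g0 no_root.
have power_of_two (x : F) : mu_ind t x = 1%N -> exists a : 'I_t, x * h = 2%:R ^+ a.
  rewrite /mu_ind; case: eqP => // x_t _.
  have : (x * h) ^+ t = 1 by rewrite exprMn x_t h_t mulr1.
  by case/(prim_rootP t_prim) => a ->; exists a.
have [a ea] := power_of_two _ H1.
have [b eb] := power_of_two _ H2.
have [c ec] := power_of_two _ H3.
pose g := (2 ^ a + 2 ^ (b + t) + 2 ^ (c + (t + t)))%N.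
have lt_ab : (a < b + t)%N by apply: leq_trans (ltn_ord a) _; rewrite leq_addl.
have lt_bc : (b + t < c + (t + t))%N.
  by rewrite addnA ltn_add2r; apply: leq_trans (ltn_ord b) _; rewrite leq_addl.
exists g; split; last exact: digits_three_powers.
apply: primitive_root_modP => //; first by rewrite /g !addn_gt0 expn_gt0.
have t1 : (2%:R : F) ^+ t = 1 := prim_expr_order t_prim.
have -> : (g%:R : 'F_p) = (h1 + h2 + h3) * h.
  rewrite /g !natrD !natrX !exprD t1 !mulr1 -ea -eb -ec; ring.
have pred_p : p.-1 = (n * t)%N := congr1 predn p_eq.
by rewrite pred_p.
Qed.

Lemma size_primes_lt (k m : nat) : (0 < m)%N -> (m < 2 ^ k)%N -> (size (primes m) <= k)%N.
Proof.
move=> m_gt0 lt_m; have : (2 ^ size (primes m) <= m)%N.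
  apply: leq_trans (prod_primes_le m_gt0).
  have -> : (2 ^ size (primes m) = \prod_(q <- primes m) 2)%N.
    by rewrite big_const_seq count_predT iter_muln_1.
  rewrite big_seq [X in (_ <= X)%N]big_seq; apply: leq_prod => q.
  by rewrite mem_primes => /andP[/prime_gt1].
move=> /leq_ltn_trans /(_ lt_m); rewrite ltn_exp2l //; exact: ltnW.
Qed.

Lemma card_small_order (N p0 T : nat) (A : {set 'I_N}) :
  (forall p : 'I_N, p \in A -> prime p /\ ((p0 <= p)%N ->
     exists t, [/\ (0 < t)%N, (t <= T)%N & (p %| 2 ^ t - 1)%N])) ->
  (#|A| <= p0 + T ^ 2)%N.
Proof.
move=> small.
pose s := iota 0 p0 ++ flatten [seq primes (2 ^ k - 1) | k <- iota 1 T].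
have pow_gt1 k : (k \in iota 1 T) -> (0 < 2 ^ k - 1)%N.
  rewrite mem_iota => /andP[k_gt0 _].
  by rewrite subn_gt0 -[X in (X < _)%N](expn0 2) ltn_exp2l.
have size_s : (size s <= p0 + T ^ 2)%N.
  rewrite size_cat size_iota leq_add2l size_flatten sumnE /shape -map_comp big_map.
  apply: (@leq_trans (\sum_(k <- iota 1 T) T)%N); last first.
    by rewrite big_const_seq count_predT size_iota iter_addn_0 mulnn.
  rewrite big_seq [X in (_ <= X)%N]big_seq; apply: leq_sum => k k_in /=.
  have := k_in; rewrite mem_iota add1n ltnS => /andP[_ le_k].
  apply: leq_trans le_k; apply: size_primes_lt; first exact: pow_gt1.
  by rewrite subn1 prednK ?expn_gt0.
apply: leq_trans size_s; rewrite cardE -(size_map (val : 'I_N -> nat)).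
apply: uniq_leq_size; first by rewrite map_inj_uniq ?enum_uniq //; apply: val_inj.
move=> _ /mapP[p + ->]; rewrite mem_enum => /small[p_pr small_p].
rewrite mem_cat mem_iota leq0n add0n /=; case: ltnP => //= /small_p[t [t_gt0 le_t p_dvd]].
have t_in : t \in iota 1 T by rewrite mem_iota t_gt0 add1n ltnS.
apply/flattenP; exists (primes (2 ^ t - 1)); first exact: map_f.
by rewrite mem_primes p_pr p_dvd pow_gt1.
Qed.

Lemma exceptional_count_le (R : realType) : exists p0 : nat, forall Q : R, 0 <= Q ->
  exists T : nat, (exceptional_count Q <= p0 + T ^ 2)%N /\ T%:R ^+ 33 <= Q ^+ 13.
Proof.
have [p0 small] := exceptional_prime_small_order; exists p0 => Q Q_ge0.
pose N := Num.truncn Q.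
have exT : exists T, (T ^ 33 <= N ^ 13)%N by exists 0%N.
have boundT T : (T ^ 33 <= N ^ 13)%N -> (T <= N ^ 13)%N.
  by apply: leq_trans; case: T => // T; rewrite -{1}[T.+1]expn1 leq_pexp2l.
have [T leT maxT] := ex_maxnP exT boundT; exists T; split; last first.
  have leNQ : N%:R <= Q by rewrite Num.Theory.truncn_le.
  apply: (@le_trans _ _ (N%:R ^+ 13)); first by rewrite -!natrX ler_nat.
  by rewrite lerXn2r ?nnegrE.
apply: card_small_order => p; rewrite inE => /andP[p_pr exc]; split => // le_p.
have [t [t_gt0 lt_t p_dvd]] := small p le_p p_pr exc; exists t; split => //.
apply: maxT; apply: leq_trans (ltnW lt_t) _; rewrite leq_exp2r //.
by rewrite -ltnS; apply: ltn_ord.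
Qed.

Theorem theorem5 (R : realType) (eps : R) (eps_gt0 : 0 < eps) :
  exists Q0 : R, forall Q : R, Q0 <= Q ->
    (exceptional_count Q)%:R <= Q `^ (26 / 33 + eps).
Proof.
have [p0 count_le] := exceptional_count_le R.
exists (Num.max 1 ((p0.+1%:R : R) `^ eps^-1)) => Q.
rewrite ge_max => /andP[Q_ge1 Q_ge].
have Q_gt0 : 0 < Q := lt_le_trans ltr01 Q_ge1.
have [T [le_count leT]] := count_le Q (ltW Q_gt0).
have le_T : T%:R <= Q `^ (13 / 33).
  have -> : T%:R = (T%:R ^+ 33) `^ (33^-1) :> R.
    by rewrite -powR_mulrn // -powRrM mulfV // powRr1.
  have -> : Q `^ (13 / 33) = (Q ^+ 13) `^ (33^-1).
    by rewrite -powR_mulrn ?(ltW Q_gt0) // -powRrM.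
  by apply: ge0_ler_powR; rewrite ?nnegrE ?exprn_ge0 ?invr_ge0 // ltW.
have le_T2 : (T ^ 2)%:R <= Q `^ (26 / 33).
  have -> : (26 / 33 : R) = 13 / 33 + 13 / 33 by lra.
  rewrite powRD; last by rewrite (gt_eqF Q_gt0) implybT.
  by rewrite natrX expr2 ler_pM.
have Qa_ge1 : 1 <= Q `^ (26 / 33).
  have a_ge0 : 0 <= 26 / 33 :> R by lra.
  by have := ler_powR Q_ge1 a_ge0; rewrite powRr0.
have Qe_ge : p0.+1%:R <= Q `^ eps.
  have -> : p0.+1%:R = (p0.+1%:R `^ eps^-1) `^ eps :> R.
    by rewrite -powRrM mulVf ?gt_eqF // powRr1.
  by apply: ge0_ler_powR; rewrite ?nnegrE ?powR_ge0 // ltW.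
rewrite powRD; last by rewrite (gt_eqF Q_gt0) implybT.
apply: (@le_trans _ _ (p0%:R + Q `^ (26 / 33))).
  by apply: le_trans (_ : (p0 + T ^ 2)%:R <= _); rewrite ?ler_nat // natrD lerD2l.
have : Q `^ (26 / 33) * p0.+1%:R <= Q `^ (26 / 33) * Q `^ eps.
  by rewrite ler_wpM2l // (le_trans ler01).
apply: le_trans; rewrite -(natr1 p0) mulrDr mulr1 lerD2r.
by rewrite ler_peMl.
Qed.
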